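(* If $\alpha\ge 0$, then $$\|e^{-tH_\alpha}\|_{\ell^1(\sigma_\alpha)\to\ell^\infty(\sigma_\alpha^{-1})}=\frac{1}{(1+t)^{1+\alpha}},\quad t>0.$$ If $\alpha\in(-1,0)$, then $$\|e^{-tH_\alpha}\|_{\ell^1(\sigma_\alpha)\to\ell^\infty(\sigma_\alpha^{-1})}\ge\frac{1}{(1+t)^{1+\alpha}},\quad t>0.$$
   Context: For $\alpha>-1$ and a complex sequence $u=(u_n)_{n\ge 0}$ (with $u_{-1}:=0$) put $$(\tau_\alpha u)_n=-\sqrt{n(n+\alpha)}\,u_{n-1}+(2n+1+\alpha)u_n-\sqrt{(n+1)(n+1+\alpha)}\,u_{n+1},\quad n\ge 0.$$ The discrete Laguerre operator $H_\alpha$ in $\ell^2(\mathbb{Z}_{\ge 0})$ is $H_\alpha u=\tau_\alpha u$ with domain $\{u\in\ell^2(\mathbb{Z}_{\ge0}) : \tau_\alpha u\in\ell^2(\mathbb{Z}_{\ge0})\}$; it is self-adjoint and nonnegative. $\sigma_\alpha(n):=\left(\frac{(\alpha+1)_n}{n!}\right)^{1/2}$, where $(x)_0:=1$, $(x)_n:=x(x+1)\cdots(x+n-1)$ for $n\ge1$. For a positive sequence $\sigma=(\sigma_n)_{n\ge0}$, $\|u\|_{\ell^1(\sigma)}=\sum_{n\ge0}|u_n|\sigma_n$ and $\|u\|_{\ell^\infty(\sigma)}=\sup_{n\ge0}|u_n|\sigma_n$; thus $\|u\|_{\ell^\infty(\sigma_\alpha^{-1})}=\sup_n|u_n|/\sigma_\alpha(n)$.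 The norm $\|e^{-tH_\alpha}\|_{\ell^1(\sigma_\alpha)\to\ell^\infty(\sigma_\alpha^{-1})}\in[0,\infty]$ is the supremum of $\|e^{-tH_\alpha}u\|_{\ell^\infty(\sigma_\alpha^{-1})}$ over finitely supported $u$ with $\|u\|_{\ell^1(\sigma_\alpha)}\le1$; equivalently it equals $\sup_{n,m\ge0}\frac{|\langle e^{-tH_\alpha}\delta_n,\delta_m\rangle_{\ell^2}|}{\sigma_\alpha(n)\sigma_\alpha(m)}$, where $\delta_n$ is the standard basis of $\ell^2(\mathbb{Z}_{\ge0})$. *)

(* Defs.v *)
From HB Require Import structures.
From mathcomp Require Import all_boot all_order all_algebra.
From mathcomp Require Import complex.
From mathcomp Require Import all_classical all_reals all_analysis.

Set Implicit Arguments.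
Unset Strict Implicit.
Unset Printing Implicit Defensive.

Import Order.TTheory GRing.Theory Num.Theory.
Import numFieldNormedType.Exports.
Import ComplexField.Normc.

Local Open Scope classical_set_scope.
Local Open Scope ring_scope.
Local Open Scope complex_scope.

Section Ell2.
Variable R : realType.

Definition cseq := nat -> R[i].

(* The squared l^2 norm; it is +oo outside l^2. *)
Definition l2sq (u : cseq) : \bar R :=
  (\sum_(0 <= n <oo) (normc (u n) ^+ 2)%:E)%E.

Definition ell2 : set cseq := [set u | (l2sq u < +oo)%E].

(* f(h) --> v in l^2-norm as h decreases to 0 *)
Definition cvg_l2_right0 (f : R -> cseq) (v : cseq) : Prop :=
  l2sq (fun n => f h n - v n) @[h --> (0 : R)^'+] --> (0 : \bar R)%E.

End Ell2.

Section Semigroup.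
Variable R : realType.
Local Notation V := (cseq R).

(* An unbounded operator in l^2 is represented by its graph, so equality of
   operators includes equality of their domains. *)
Definition l2_operator := set (V * V).

Definition opp_operator (A : l2_operator) : l2_operator :=
  [set p | A (p.1, fun n => - p.2 n)].

(* Only the values T t u for t >= 0 and u in l^2 are meaningful. *)
Record is_C0_semigroup (T : R -> V -> V) : Prop := IsC0Semigroup {
  C0_ell2 : forall t u, 0 <= t -> ell2 u -> ell2 (T t u);
  C0_linear : forall t (c : R[i]) u v, 0 <= t -> ell2 u -> ell2 v ->
    T t (fun n => c * u n + v n) = (fun n => c * T t u n + T t v n);
  C0_bounded : forall t, 0 <= t -> exists M : R,
    forall u, ell2 u -> (l2sq (T t u) <= M%:E * l2sq u)%E;
  C0_id : forall u, ell2 u -> T 0 u = u;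
  C0_add : forall s t u, 0 <= s -> 0 <= t -> ell2 u ->
    T (s + t) u = T s (T t u);
  C0_continuous : forall u, ell2 u -> cvg_l2_right0 (fun h => T h u) u
}.

Definition generator (T : R -> V -> V) : l2_operator :=
  [set p | [/\ ell2 p.1, ell2 p.2 &
    cvg_l2_right0 (fun h n => (h^-1)%:C * (T h p.1 n - p.1 n)) p.2]].

(* exp_operator A t is e^{tA}, for t >= 0: the operators of the C_0-semigroup
   on l^2 generated by A.  A C_0-semigroup is determined on l^2 by its
   generator, so the choice made by xget does not affect the values on l^2; the
   default 0 is taken only if A generates no C_0-semigroup. *)
Definition exp_operator (A : l2_operator) : R -> V -> V :=
  xget (fun _ _ _ => 0) [set T | is_C0_semigroup T /\ generator T = A].

End Semigroup.

Section WeightedNorms.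
Variable R : realType.
Local Notation V := (cseq R).

Definition l1norm (w : nat -> R) (u : V) : \bar R :=
  (\sum_(0 <= n <oo) (normc (u n) * w n)%:E)%E.

Definition linfnorm (w : nat -> R) (u : V) : \bar R :=
  ereal_sup [set (normc (u n) * w n)%:E | n in [set: nat]].

Definition finitely_supported (u : V) : Prop :=
  exists N : nat, forall n, (N <= n)%N -> u n = 0.

(* The norm of B from l^1(w) to l^oo(w'), with values in [0, +oo] *)
Definition norm_l1_linf (w w' : nat -> R) (B : V -> V) : \bar R :=
  ereal_sup [set linfnorm w' (B u) |
    u in [set u : V | finitely_supported u /\ (l1norm w u <= 1)%E]].

End WeightedNorms.

Section Laguerre.
Variable R : realType.
Local Notation V := (cseq R).

(* u_{n-1}, with u_{-1} := 0 *)
Definition prev (u : V) (n : nat) : R[i] := if n is m.+1 then u m else 0.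

Definition tau (alpha : R) (u : V) : V := fun n =>
  - (Num.sqrt (n%:R * (n%:R + alpha)))%:C * prev u n
  + (2 * n%:R + 1 + alpha)%:C * u n
  - (Num.sqrt (n.+1%:R * (n.+1%:R + alpha)))%:C * u n.+1.

(* The discrete Laguerre operator H_alpha, on its maximal domain *)
Definition laguerre (alpha : R) : l2_operator R :=
  [set p | [/\ ell2 p.1, ell2 (tau alpha p.1) & p.2 = tau alpha p.1]].

(* e^{-t H_alpha} *)
Definition laguerre_heat (alpha : R) : R -> V -> V :=
  exp_operator (opp_operator (laguerre alpha)).

Definition pochhammer (x : R) (n : nat) : R := \prod_(k < n) (x + k%:R).

Definition sigma (alpha : R) (n : nat) : R :=
  Num.sqrt (pochhammer (alpha + 1) n / (n`!)%:R).

End Laguerre.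

(* Main.v *)
Require Import Defs.
From HB Require Import structures.
From mathcomp Require Import all_boot all_order all_algebra.
From mathcomp Require Import complex ring lra.
From mathcomp Require Import all_classical all_reals all_analysis.

Set Implicit Arguments.
Unset Strict Implicit.
Unset Printing Implicit Defensive.

Import Order.TTheory GRing.Theory Num.Theory.
Import numFieldNormedType.Exports.

Local Open Scope ring_scope.

(** The operator e^{-tH} has an explicit kernel.  Put beta = alpha + 1 and let
    B(n, k) be the coefficient of z^k in (t + z)^n.  Then
      p_t(n, m) = sigma_n sigma_m (1 + t)^(- beta - n - m)
                    sum_k (k! / (beta)_k) B(n, k) B(m, k).
    The numbers B(n, k) / (1 + t)^n are the probabilities of a binomial variable.
    If alpha >= 0, then k! <= (beta)_k, so that p_t(n, m) / (sigma_n sigma_m) is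
    at most (1 + t)^(- beta) times the probability that two independent binomial
    variables coincide, hence at most (1 + t)^(- beta) (ker_le).  At n = m = 0 the
    sum is 1 (ker00), which gives the lower bound for every alpha > -1.

    The work is to show that p_t is the kernel of the C_0-semigroup generated by
    -H on its maximal domain: that such a semigroup exists, and that it is the
    only one.  The kernel solves the heat equation dp/dt = - tau p in one index
    (is_derive_ker), is the identity at t = 0, and decays geometrically along its
    rows, uniformly for bounded times (ker_decay).  Hence, for a coordinatewise
    solution y of y' = - tau y of polynomial growth, the sum over m of
    p_{T-s}(n, m) y_m(s) is constant in s: its truncations have derivatives equal
    to one boundary term each, which tends to 0 (kernel_variation,
    kernel_trajectory).  This is used for
    - y = sigma, a stationary solution: sum_m p_t(n, m) sigma_m = sigma_n, and
      Schur's test makes p_t a contraction of l^2 (ker_schur);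
    - y_m(s) = p_{r+s}(l, m), which gives the semigroup law (ker_semigroup);
    - y = x constant with a source term, which gives the expansion
      e^{-hH} x = x - h H x + o(h) in l^2 for all x in the maximal domain
      (heat_expansion), hence strong continuity and one half of the computation
      of the generator; the other half follows from the symmetry of the kernel
      (heat_generator_tau);
    - y(s) = T_s u for any semigroup T generated by -H and u in the domain of H,
      which gives T_t u = e^{-tH} u (semigroup_heat).  Here the trajectory is only
      known to be differentiable from the right.  Left continuity follows once
      the operators T_s are uniformly bounded for bounded times, that is, from
      the uniform boundedness principle on l^2 (uniform_bound_near0), and
      continuous functions with vanishing right derivative are constant
      (right_derive_bound).

    Bounds in l^2 are stated on partial sums and for real sequences; the kernel
    being real, complex sequences are handled through real and imaginary parts. *)


(** * Square-summable real sequences *)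

Lemma cvg_fsum (R : realFieldType) (T : Type) (F : set_system T) {FF : Filter F}
    (N : nat) (f : nat -> T -> R) (l : nat -> R) :
  (forall i, (i < N)%N -> f i t @[t --> F] --> l i)%classic ->
  (\sum_(i < N) f i t @[t --> F] --> \sum_(i < N) l i)%classic.
Proof.
move=> fl; apply: (@cvg_big _ _ +%R 0 xpredT _ _ F) => [|i _].
  exact: add_continuous.
exact: fl.
Qed.

Lemma cvgn_norm_le (R : realFieldType) (f : nat -> R) (l c : R) :
  (f @ \oo --> l)%classic -> (\forall n \near \oo, `|f n| <= c)%classic ->
  `|l| <= c.
Proof.
move=> fl fc.
have cn : (`|f n| @[n --> \oo] --> `|l|)%classic by exact: cvg_norm.
by rewrite -(cvg_lim _ cn)//; apply: limr_le => //; apply/cvg_ex; exists `|l|.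
Qed.

Section RealL2.
Variable R : realType.
Implicit Types (x y : nat -> R) (a b c e : R) (N M : nat).

(** The bound ||x|| <= a on the norm of l^2, stated through partial sums so that
    it also asserts that x lies in l^2. *)
Definition l2le x a := 0 <= a /\ forall N, \sum_(i < N) x i ^+ 2 <= a ^+ 2.

Definition trunc M x := fun i => if (i < M)%N then x i else 0.

Definition dot x y : R := limn (series (fun i => x i * y i)).

Lemma l2le_ext x y a : (forall i, x i = y i) -> l2le x a -> l2le y a.
Proof. by move=> /funext ->. Qed.

Lemma l2le_ge0 x a : l2le x a -> 0 <= a.
Proof. by case. Qed.

Lemma l2le_mono x a b : a <= b -> l2le x a -> l2le x b.
Proof.
move=> ab [a0 xa]; have b0 := le_trans a0 ab.
by split=> // N; rewrite (le_trans (xa N))// ler_sqr.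
Qed.

Lemma l2le0 a : 0 <= a -> l2le (fun=> 0) a.
Proof.
by move=> a0; split=> // N; rewrite big1 ?sqr_ge0// => i _; rewrite expr0n.
Qed.

(** The induction step is the arithmetic-geometric mean inequality applied to the
    cross term. *)
Lemma cauchy_sum N x y :
  (\sum_(i < N) x i * y i) ^+ 2 <=
  (\sum_(i < N) x i ^+ 2) * (\sum_(i < N) y i ^+ 2).
Proof.
elim: N => [|N IH]; first by rewrite !big_ord0 expr0n mul0r.
rewrite !big_ord_recr /=.
set S := \sum_(i < N) _ * _ in IH *.
set A := \sum_(i < N) x _ ^+ 2 in IH *; set B := \sum_(i < N) y _ ^+ 2 in IH *.
have A0 : 0 <= A by apply: sumr_ge0 => i _; exact: sqr_ge0.
have B0 : 0 <= B by apply: sumr_ge0 => i _; exact: sqr_ge0.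
clearbody S A B; have key : 2 * S * (x N * y N) <= A * y N ^+ 2 + B * x N ^+ 2.
  apply: le_trans (ler_norm _) _.
  have nn : 0 <= A * y N ^+ 2 + B * x N ^+ 2.
    by apply: addr_ge0; apply: mulr_ge0 => //; exact: sqr_ge0.
  rewrite -ler_sqr ?nnegrE//.
  rewrite real_normK ?num_real// !exprMn.
  have h1 : S ^+ 2 * (x N ^+ 2 * y N ^+ 2) <= A * B * (x N ^+ 2 * y N ^+ 2).
    by apply: ler_wpM2r IH; apply: mulr_ge0; exact: sqr_ge0.
  have h2 := sqr_ge0 (A * y N ^+ 2 - B * x N ^+ 2).
  rewrite -subr_ge0; move: h1; rewrite -subr_ge0 => h1.
  apply: le_trans (addr_ge0 h2 (mulr_ge0 (ler0n R 4) h1)) _.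
  by rewrite le_eqVlt; apply/orP; left; apply/eqP; ring.
move: IH; rewrite -subr_ge0 => IH; move: key; rewrite -subr_ge0 => key.
rewrite sqrrD -subr_ge0.
apply: le_trans (addr_ge0 IH key) _.
by rewrite le_eqVlt; apply/orP; left; apply/eqP; ring.
Qed.

Lemma dot_bound N x y a b : l2le x a -> l2le y b ->
  `|\sum_(i < N) x i * y i| <= a * b.
Proof.
move=> [a0 xa] [b0 yb].
rewrite -ler_sqr ?nnegrE ?normr_ge0 ?mulr_ge0// real_normK ?num_real//.
apply: le_trans (cauchy_sum _ _ _) _.
by rewrite exprMn ler_pM// sumr_ge0// => i _; exact: sqr_ge0.
Qed.

Lemma l2leD x y a b : l2le x a -> l2le y b ->
  l2le (fun i => x i + y i) (a + b).
Proof.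
move=> xa yb; have [[a0 xa'] [b0 yb']] := (xa, yb); split=> [|N]; first exact: addr_ge0.
under eq_bigr do rewrite sqrrD.
rewrite !big_split /= sqrrD mulr2n.
have h1 := xa' N; have h2 := yb' N.
by have := dot_bound N xa yb; rewrite ler_norml => /andP[_ h]; lra.
Qed.

Lemma l2leZ c x a : l2le x a -> l2le (fun i => c * x i) (`|c| * a).
Proof.
move=> [a0 xa]; split=> [|N]; first by rewrite mulr_ge0.
under eq_bigr do rewrite exprMn.
by rewrite -mulr_sumr exprMn real_normK ?num_real// ler_wpM2l ?sqr_ge0.
Qed.

Lemma l2leN x a : l2le x a -> l2le (fun i => - x i) a.
Proof. by move=> [a0 xa]; split=> // N; under eq_bigr do rewrite sqrrN. Qed.

Lemma l2leB x y a b : l2le x a -> l2le y b ->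
  l2le (fun i => x i - y i) (a + b).
Proof. by move=> xa yb; apply: l2leD => //; exact: l2leN. Qed.

Lemma l2le_coord x a n : l2le x a -> `|x n| <= a.
Proof.
move=> [a0 xa]; rewrite -ler_sqr ?nnegrE// real_normK ?num_real//.
apply: le_trans (xa n.+1); rewrite big_ord_recr /= lerDr.
by apply: sumr_ge0 => i _; exact: sqr_ge0.
Qed.

Lemma l2_trunc M x : exists a, l2le (trunc M x) a.
Proof.
exists (Num.sqrt (\sum_(i < M) x i ^+ 2)); split; first exact: sqrtr_ge0.
move=> N; rewrite sqr_sqrtr; last by apply: sumr_ge0 => i _; exact: sqr_ge0.
have -> : \sum_(i < M) x i ^+ 2 = \sum_(i < M) trunc M x i ^+ 2.
  by apply: eq_bigr => i _; rewrite /trunc ltn_ord.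
rewrite -!(big_mkord xpredT (fun i => trunc M x i ^+ 2)).
have [NM|/ltnW MN] := leqP N M.
  by rewrite (big_cat_nat (leq0n _) NM)//= lerDl sumr_ge0// => i _; exact: sqr_ge0.
rewrite (big_cat_nat (leq0n _) MN)//= gerDl.
rewrite big_nat_cond sumr_le0// => i /andP[/andP[Mi _] _].
by rewrite /trunc ltnNge Mi expr0n.
Qed.

(** The bound survives coordinatewise limits, as in Fatou's lemma; applied to
    limits of Cauchy sequences it plays the role of the completeness of l^2. *)
Lemma l2le_cvg (u : nat -> nat -> R) x a :
  (forall n, u j n @[j --> \oo] --> x n)%classic ->
  (\forall j \near \oo, l2le (u j) a)%classic -> l2le x a.
Proof.
move=> ux ua; have [j0 _ hj] := ua.
split=> [|N]; first exact: l2le_ge0 (hj j0 (leqnn _)).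
have c : (\sum_(i < N) u j i ^+ 2 @[j --> \oo] --> \sum_(i < N) x i ^+ 2)%classic.
  apply: (@cvg_fsum _ _ _ _ N (fun i j => u j i ^+ 2) (fun i => x i ^+ 2)) => i _.
  by apply: cvgM; exact: ux.
rewrite -(cvg_lim _ c)//; apply: limr_le; first by apply/cvg_ex; eexists; exact: c.
by near=> j; have [] : l2le (u j) a by near: j.
Unshelve. all: by end_near. Qed.

Lemma sum_series x N : \sum_(i < N) x i = series x N.
Proof. by rewrite /series /= big_mkord. Qed.

Lemma cvg_sqsum x a : l2le x a -> cvgn (series (fun i => x i ^+ 2)).
Proof.
move=> [a0 xa]; apply: nondecreasing_is_cvgn.
  by apply: nondecreasing_series => i _ _; exact: sqr_ge0.
by exists (a ^+ 2) => _ [N _ <-]; rewrite -sum_series.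
Qed.

Lemma dot_cvg x y a b : l2le x a -> l2le y b ->
  (\sum_(i < N) x i * y i @[N --> \oo] --> dot x y)%classic.
Proof.
move=> xa yb; under eq_cvg do rewrite (sum_series (fun i => x i * y i)).
apply: normed_cvg.
apply: (@series_le_cvg _ _ (fun i => x i ^+ 2 + y i ^+ 2)) => [i|i|i|] /=.
- exact: normr_ge0.
- by rewrite addr_ge0 ?sqr_ge0.
- have := sqr_ge0 (`|x i| - `|y i|).
  rewrite normrM sqrrB !real_normK ?num_real// => h.
  have := normr_ge0 (x i); have := normr_ge0 (y i) => h1 h2.
  have := mulr_ge0 h1 h2; lra.
- have /= := is_cvg_seriesD (cvg_sqsum xa) (cvg_sqsum yb).
  done.
Qed.

Lemma dot_le x y a b : l2le x a -> l2le y b -> `|dot x y| <= a * b.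
Proof.
move=> xa yb; apply: (cvgn_norm_le (dot_cvg xa yb)); near=> N.
exact: dot_bound.
Unshelve. all: by end_near. Qed.

Lemma l2le_tail x a e : l2le x a -> 0 < e ->
  exists M0, forall M, (M0 <= M)%N -> l2le (fun i => x i - trunc M x i) e.
Proof.
move=> xa e0.
have /cauchy_cvgP/cauchy_seriesP := cvg_sqsum xa.
move=> /(_ _ (exprn_gt0 2 e0)) [] [A B] /= [[a' _ hA] [b' _ hB]] h.
exists (maxn a' b') => M; rewrite geq_max => /andP[aM bM].
split=> [|N]; first exact: ltW.
have [NM|MN] := leqP N M.
  rewrite big1 ?sqr_ge0// => i _.
  by rewrite /trunc (leq_trans (ltn_ord i) NM) subrr expr0n.
rewrite -(big_mkord xpredT (fun i => (x i - trunc M x i) ^+ 2)).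
rewrite (big_cat_nat (leq0n _) (ltnW MN))//=.
have -> : \sum_(0 <= i < M) (x i - trunc M x i) ^+ 2 = 0.
  rewrite big_nat_cond big1// => i /andP[/andP[_ iM] _].
  by rewrite /trunc iM subrr expr0n.
rewrite add0r.
have hMN : `|\sum_(M <= i < N) x i ^+ 2| < e ^+ 2.
  by apply: (h (M, N)); split; [exact: hA|apply: hB; exact: leq_trans bM (ltnW MN)].
rewrite (eq_big_nat _ _ (F2 := fun i => x i ^+ 2)); last first.
  by move=> i /andP[Mi _]; rewrite /trunc ltnNge Mi /= subr0.
by apply: le_trans (ltW hMN); exact: ler_norm.
Qed.

End RealL2.

(** * Uniform boundedness *)

Section UniformBound.
Variable R : realType.
Local Notation l2 x := (exists a : R, l2le x a).

(** The uniform boundedness principle for operators F s on l^2 that are bounded,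
    vector by vector, as s decreases to 0.  If they were not uniformly bounded,
    then inside every ball there would be a smaller one on which some F s with s
    small exceeds a prescribed bound; the common point of a nested sequence of
    such balls contradicts the bound at that point. *)
Lemma uniform_bound_near0 (F : R -> (nat -> R) -> nat -> R) :
  (forall (s : R) x y, 0 <= s -> l2 x -> l2 y ->
    F s (fun i => x i + y i) = (fun i => F s x i + F s y i)) ->
  (forall (s c : R) x, 0 <= s -> l2 x ->
    F s (fun i => c * x i) = (fun i => c * F s x i)) ->
  (forall s : R, 0 <= s ->
    exists C : R, forall x a, l2le x a -> l2le (F s x) (C * a)) ->
  (forall x, l2 x -> exists C d : R, 0 < d /\
    forall s, 0 <= s <= d -> l2le (F s x) C) ->
  exists C d : R, 0 < d /\
    forall s, 0 <= s <= d -> forall x a, l2le x a -> l2le (F s x) (C * a).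
Proof.
move=> FD FZ Fb Fp; apply: contrapT => nbd.
pose good k (p p' : (nat -> R) * R) := [/\ l2 p'.1, 0 < p'.2,
  p'.2 <= p.2 / 2, l2le (fun i => p'.1 i - p.1 i) (p.2 / 2) &
  exists2 s : R, 0 <= s <= k.+1%:R^-1 &
    forall x, l2le (fun i => x i - p'.1 i) p'.2 -> ~ l2le (F s x) k%:R].
have step (kp : nat * ((nat -> R) * R)) : exists p',
    l2 kp.2.1 -> 0 < kp.2.2 -> good kp.1 kp.2 p'.
  case: kp => k [x r] /=.
  have [[l2x r0]|nh] := pselect (l2 x /\ 0 < r); last first.
    by exists (x, r) => h1 h2; case: nh.
  suff [p' gp'] : exists p', good k (x, r) p' by exists p'.
  pose B := 4 * k.+1%:R / r.
  have B0 : 0 < B by rewrite divr_gt0 ?mulr_gt0.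
  (* no uniform bound: some vector is stretched by more than B at a small time *)
  have [s [hs [xi [a [xia nFxi]]]]] : exists s : R, 0 <= s <= k.+1%:R^-1 /\
      exists xi a, l2le xi a /\ ~ l2le (F s xi) (B * a).
    apply: contrapT => h; apply: nbd; exists B, k.+1%:R^-1; split=> // s hs xi a xia.
    apply: contrapT => nF; apply: h; exists s; split=> //; exists xi, a; split=> //.
  have s0 : 0 <= s by case/andP: hs.
  have [C hC] := Fb s s0.
  (* rescaled, it can be added to the centre x without leaving the ball *)
  have [xi' xi'r nF'] : exists2 xi', l2le xi' (r / 2) &
      ~ l2le (F s xi') (2 * k.+1%:R).
    have a0 := l2le_ge0 xia.
    have [a00|an0] := eqVneq a 0.
      exfalso; apply: nFxi; rewrite a00 mulr0.
      by move: (hC _ _ xia); rewrite a00 mulr0.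
    have ap : 0 < a by rewrite lt_neqAle eq_sym an0.
    pose c := r / 2 / a; have c0 : 0 < c by rewrite !divr_gt0.
    exists (fun i => c * xi i).
      have := l2leZ c xia; rewrite gtr0_norm//.
      by rewrite /c divfK.
    move=> h; apply: nFxi.
    have := l2leZ c^-1 h; rewrite FZ//; last by exists a.
    have -> : `|c^-1| * (2 * k.+1%:R) = B * a.
      rewrite gtr0_norm ?invr_gt0// /c /B; field.
      by rewrite an0 gt_eqF.
    by apply: l2le_ext => i; rewrite mulKf ?gt_eqF.
  have l2xi' : l2 xi' by exists (r / 2).
  (* x and x + xi' cannot both have a small image, since xi' has a large one *)
  have [y [l2y yx nFy]] : exists y, [/\ l2 y, l2le (fun i => y i - x i) (r / 2) &
      ~ l2le (F s y) k.+1%:R].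
    have [Fx|nFx] := pselect (l2le (F s x) k.+1%:R); last first.
      exists x; split=> //; apply: (l2le_ext (x := fun=> 0)) => [i|].
        by rewrite subrr.
      by apply: l2le0; rewrite divr_ge0 ?ltW.
    exists (fun i => x i + xi' i); split.
    - by have [b xb] := l2x; have [c xc] := l2xi'; exists (b + c); exact: l2leD.
    - by apply: l2le_ext xi'r => i; rewrite addrAC subrr add0r.
    - rewrite FD// => h; apply: nF'; rewrite mulr_natl mulr2n.
      by apply: l2le_ext (l2leB h Fx) => i; rewrite addrAC subrr add0r.
  (* F s is bounded, so its image stays large on a small ball around y *)
  pose r' := Num.min (r / 2) (`|C| + 1)^-1.
  have C1 : 0 < `|C| + 1 by rewrite ltr_wpDl.
  have r'0 : 0 < r' by rewrite lt_min divr_gt0//= invr_gt0.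
  exists (y, r'); split=> //=; first by rewrite ge_min lexx.
  exists s => // z zy Fz; apply: nFy.
  have l2zy : l2 (fun i => -1 * (z i - y i)) by exists (`|-1| * r'); exact: l2leZ.
  have l2z : l2 z.
    have [b yb] := l2y; exists (r' + b).
    by apply: l2le_ext (l2leD zy yb) => i; rewrite subrK.
  have -> : y = (fun i => z i + -1 * (z i - y i)).
    by apply/funext => i; rewrite mulN1r opprB addrC subrK.
  rewrite FD// -natr1; apply: l2leD => //.
  have h := hC _ _ (l2leZ (-1) zy); apply: l2le_mono h.
  rewrite normrN1 mul1r; apply: le_trans (ler_norm _) _.
  rewrite normrM (gtr0_norm r'0).
  apply: le_trans (ler_wpM2l (normr_ge0 C) (_ : r' <= (`|C| + 1)^-1)) _.
    by rewrite ge_min lexx orbT.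
  by rewrite ler_pdivrMr// mul1r lerDl.
have [f hf] := choice step.
pose S := fix S k := if k is k'.+1 then f (k', S k') else (fun=> 0 : R, 1 : R).
have S0 k : l2 (S k).1 /\ 0 < (S k).2.
  elim: k => [|k [h1 h2]]; first by split=> //=; exists 0; exact: l2le0.
  by have [] := hf (k, S k) h1 h2.
have gS k : good k (S k) (S k.+1) by have [h1 h2] := S0 k; exact: hf (k, S k) h1 h2.
(* the centres after step k stay in the k-th ball *)
have near_S j k : l2le (fun i => (S (k + j)%N).1 i - (S k).1 i) (S k).2.
  elim: j k => [|j IH] k.
    rewrite addn0; apply: (l2le_ext (x := fun=> 0)) => [i|]; first by rewrite subrr.
    by apply: l2le0; apply: ltW; have [] := S0 k.
  have [_ _ r2 x2 _] := gS k.
  have := l2leD (l2le_mono r2 (IH k.+1)) x2.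
  rewrite -splitr addSnnS; apply: l2le_ext => i.
  by rewrite addrA subrK.
have rS k : (S k).2 <= 2^-1 ^+ k.
  elim: k => [|k IH]; first by rewrite expr0.
  have [_ _ r2 _ _] := gS k; apply: le_trans r2 _.
  by rewrite exprS mulrC ler_wpM2l// invr_ge0.
have r_to0 : (2^-1 ^+ k @[k --> \oo] --> (0 : R))%classic.
  apply: cvg_expr; rewrite gtr0_norm ?invr_gt0// invf_lt1//; lra.
have cS i : cvgn (fun k => (S k).1 i).
  apply/cauchy_cvgP/cauchy_exP => e e0.
  have [K _ hK] : (\forall k \near \oo, (2^-1 : R) ^+ k < e)%classic.
    have := r_to0 => /cvgrPdist_lt/(_ _ e0).
    by apply: filterS => k; rewrite sub0r normrN; apply: le_lt_trans; exact: ler_norm.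
  have b j : (K <= j)%N -> `|(S K).1 i - (S j).1 i| < e.
    move=> Kj; rewrite distrC -(subnKC Kj).
    apply: le_lt_trans (l2le_coord i (near_S _ _)) _.
    exact: le_lt_trans (rS _) (hK K (leqnn K)).
  by exists ((S K).1 i); exists K => // j; exact: b.
pose z i := limn (fun k => (S k).1 i).
have zS k : l2le (fun i => z i - (S k).1 i) (S k).2.
  apply: (@l2le_cvg _ (fun j i => (S (j + k)%N).1 i - (S k).1 i)) => [i|].
    apply: cvgB; last exact: cvg_cst.
    rewrite (cvg_shiftn k (fun j => (S j).1 i) (nbhs (z i))).
    exact: cS.
  by apply: nearW => j; rewrite addnC; exact: near_S.
have l2z : l2 z.
  by exists (S 0%N).2; apply: l2le_ext (zS 0%N) => i /=; rewrite subr0.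
have [C [d [d0 hCd]]] := Fp z l2z.
pose k := (Num.trunc (`|C| + d^-1)).+1.
have kC : `|C| + d^-1 < k%:R by rewrite truncnS_gt.
have dV0 : 0 < d^-1 by rewrite invr_gt0.
have [_ _ _ _ [s /andP[s0 sk] hs]] := gS k.
apply: (hs z (zS _)); apply: l2le_mono (hCd s _).
  by apply: le_trans (ler_norm _) _; apply: le_trans (ltW kC); rewrite lerDl ltW.
rewrite s0 (le_trans sk)// -[d]invrK lef_pV2 ?posrE//.
apply: le_trans (ltW (_ : _ < k%:R)) _; last by rewrite ler_nat.
by apply: le_lt_trans kC; rewrite lerDr.
Qed.

End UniformBound.

(** * Functions with a small right derivative *)

Section RightSlope.
Variable R : realType.

(** A mean value inequality that only uses difference quotients from the right.
    Left continuity is what lets the bound pass through the supremum of the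
    points up to which it holds. *)
Lemma right_slope_le (f : R -> R) (a b e : R) : a <= b -> 0 <= e ->
  (forall s eta, a < s <= b -> 0 < eta -> exists d : R, 0 < d /\
    forall h, 0 < h < d -> a <= s - h -> `|f s - f (s - h)| <= eta) ->
  (forall s eta, a <= s < b -> 0 < eta -> exists d : R, 0 < d /\
    forall h, 0 < h < d -> s + h <= b -> `|f (s + h) - f s| <= (e + eta) * h) ->
  `|f b - f a| <= e * (b - a).
Proof.
move=> ab e0 lc rs.
suff H eta : 0 < eta -> `|f b - f a| <= (e + eta) * (b - a).
  have [->|nab] := eqVneq a b; first by rewrite !subrr normr0 mulr0.
  have ab' : 0 < b - a by rewrite subr_gt0 lt_neqAle nab.
  apply/ler_addgt0Pr => eta eta0.
  apply: le_trans (H (eta / (b - a)) _) _; first by rewrite divr_gt0.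
  by rewrite mulrDl divfK ?gt_eqF.
move=> eta0; set g := e + eta; have g0 : 0 < g by rewrite ltr_wpDl.
pose ok r := `|f r - f a| <= g * (r - a).
(* the points up to which the bound holds; its supremum c turns out to be b *)
pose A := [set s : R | a <= s <= b /\ forall r, a <= r <= s -> ok r]%classic.
have Aa : A a.
  split=> [|r]; first by rewrite lexx ab.
  by move=> /andP[h1 h2]; rewrite /ok (@le_anti _ _ r a) ?h1 ?h2// !subrr normr0 mulr0.
have supA : has_sup A.
  split; first by exists a.
  by exists b => s [/andP[]].
set c := sup A.
have ac : a <= c by exact: (ub_le_sup supA.2).
have cb : c <= b by apply: (ge_sup (ex_intro _ a Aa)) => s [/andP[]].
have below r : a <= r < c -> ok r.
  move=> /andP[ar rc].
  have /= [s [_ h] rs'] := sup_gt supA.1 rc.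
  by apply: h; rewrite ar ltW.
have okc : ok c.
  have [->|nac] := eqVneq c a; first by rewrite /ok !subrr normr0 mulr0.
  have ac' : a < c by rewrite lt_neqAle eq_sym nac.
  apply/ler_addgt0Pr => z z0.
  have acb : a < c <= b by rewrite ac' cb.
  have [d [d0 hd]] := lc c z acb z0.
  pose h := Num.min (d / 2) (c - a).
  have ca0 : 0 < c - a by rewrite subr_gt0.
  have h0 : 0 < h by rewrite lt_min divr_gt0.
  have hd' : h < d by rewrite gt_min ltr_pdivrMr// ltr_pMr// ltr1n.
  have hca : h <= c - a by rewrite ge_min lexx orbT.
  have ach : a <= c - h by rewrite lerBrDr -lerBrDl.
  have h1 := hd h (introT andP (conj h0 hd')) ach.
  have h2 : ok (c - h) by apply: below; rewrite ach/= ltrBlDr ltrDl.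
  have -> : f c - f a = (f c - f (c - h)) + (f (c - h) - f a) by rewrite addrA subrK.
  apply: le_trans (ler_normD _ _) _; rewrite addrC; apply: lerD => //.
  apply: le_trans h2 _; rewrite ler_wpM2l ?(ltW g0)// lerD2r gerDl oppr_le0; exact: ltW.
have Ac : A c.
  split=> [|r /andP[ar]]; first by rewrite ac.
  by rewrite le_eqVlt => /predU1P[->//|rc]; apply: below; rewrite ar.
suff <- : c = b by [].
apply: contrapT => /eqP ncb.
have cb' : c < b by rewrite lt_neqAle ncb.
have [d [d0 hd]] := rs c eta (introT andP (conj ac cb')) eta0.
pose h := Num.min (d / 2) (b - c).
have h0 : 0 < h by rewrite lt_min divr_gt0// subr_gt0.
have hd' : h < d by rewrite gt_min ltr_pdivrMr// ltr_pMr// ltr1n.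
have hcb : c + h <= b by rewrite -lerBrDl ge_min lexx orbT.
have : A (c + h).
  split=> [|r /andP[ar rch]]; first by rewrite hcb (le_trans ac)// lerDl ltW.
  have [rc|cr] := leP r c; first by apply: Ac.2; rewrite ar.
  have rE : c + (r - c) = r by rewrite addrC subrK.
  have rc0 : 0 < r - c by rewrite subr_gt0.
  have := hd (r - c); rewrite rE rc0 /= => /(_ _ _).
  have rcd : r - c < d by apply: le_lt_trans hd'; rewrite lerBlDl.
  move=> /(_ rcd (le_trans rch hcb)) h1; rewrite /ok.
  have -> : f r - f a = (f r - f c) + (f c - f a) by rewrite addrA subrK.
  apply: le_trans (ler_normD _ _) _.
  have -> : r - a = (r - c) + (c - a) by rewrite addrA subrK.
  by rewrite mulrDr lerD.
move=> /(ub_le_sup supA.2); rewrite -/c; apply/negP.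
by rewrite -ltNge ltrDl.
Qed.

End RightSlope.

(** * The heat kernel *)

Section HeatKernel.
Variables (R : realType) (alpha : R).
Implicit Types (t : R) (n m k : nat) (x : nat -> R).
Local Notation beta := (alpha + 1).
Local Notation sg := (sigma alpha).

(** The coefficient of z^k in (t + z)^n. *)
Definition binpow t n k : R := 'C(n, k)%:R * t ^+ (n - k).

Definition weight k : R := k`!%:R / pochhammer beta k.

Definition kersum t n m : R :=
  \sum_(k < n.+1) weight k * binpow t n k * binpow t m k.

(** The matrix of e^{-tH}.  In the orthonormal basis of normalized Laguerre
    polynomials L_n it is the Laplace transform of L_n L_m x^alpha e^{-x}; the
    generating function of p_t(n, m) sigma_n sigma_m is
    ((1 + t - t z) (1 + t - t w) - z w)^{-beta} (1 + t)^beta, and its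
    expansion in powers of z w gives this sum of nonnegative terms. *)
Definition heat_kernel t n m : R :=
  sg n * sg m * ((1 + t) `^ (- (beta + (n + m)%:R)) * kersum t n m).

Local Notation ker := heat_kernel.

Lemma binpow_small t n k : (n < k)%N -> binpow t n k = 0.
Proof. by move=> nk; rewrite /binpow bin_small// mul0r. Qed.

Lemma binpowS0 t n : binpow t n.+1 0 = t * binpow t n 0.
Proof. by rewrite /binpow !bin0 !subn0 !mul1r exprS. Qed.

Lemma binpowSS t n k : binpow t n.+1 k.+1 = t * binpow t n k.+1 + binpow t n k.
Proof.
rewrite /binpow binS natrD mulrDl subSS; congr (_ + _).
have [nk|kn] := leqP n k; first by rewrite bin_small// !mul0r mulr0.
by rewrite mulrCA -exprS -subSn.
Qed.

Lemma binpow_absorb t n k : n.+1%:R * binpow t n k = k.+1%:R * binpow t n.+1 k.+1.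
Proof. by rewrite /binpow !mulrA -!natrM mul_bin_diag subSS. Qed.

(** Euler's identity for the homogeneous polynomial (t + z)^n. *)
Lemma binpow_euler t n k :
  n%:R * binpow t n k = t * (k.+1%:R * binpow t n k.+1) + k%:R * binpow t n k.
Proof.
have [nk|kn] := ltnP n k; first by rewrite !binpow_small ?mulr0 ?addr0// ltnW.
have -> : t * (k.+1%:R * binpow t n k.+1) = (n - k)%:R * binpow t n k.
  rewrite /binpow [k.+1%:R * _]mulrA -natrM mul_bin_left natrM.
  have [kn'|nk] := ltnP k n; last by rewrite (eqP nk) !mul0r mulr0.
  by rewrite -[(n - k)%N]prednK ?subn_gt0// -subnS exprS; ring.
by rewrite -mulrDl -natrD subnK.
Qed.

Lemma is_derive_binpow t n k :
  is_derive t 1 (fun s => binpow s n k) (k.+1%:R * binpow t n k.+1).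
Proof.
rewrite /binpow.
have -> : (fun s : R => 'C(n, k)%:R * s ^+ (n - k)) =
          'C(n, k)%:R \*: ((@id R) ^+ (n - k)).
  by apply/funext => s; rewrite /= /GRing.scale /= fctE.
apply: is_derive_eq.
rewrite /GRing.scale /= mulr1 !mulrA -!natrM mul_bin_left subnS.
by rewrite mulnC.
Qed.

Hypothesis alphaN1 : -1 < alpha.

Lemma beta_gt0 : 0 < beta. Proof. by rewrite -ltrBlDr sub0r. Qed.

Lemma pochhammerS (b : R) k : pochhammer b k.+1 = pochhammer b k * (b + k%:R).
Proof. by rewrite /pochhammer big_ord_recr. Qed.

Lemma pochhammer_gt0 k : 0 < pochhammer beta k.
Proof. by apply: prodr_gt0 => i _; rewrite ltr_wpDr// beta_gt0. Qed.

Lemma weight_gt0 k : 0 < weight k.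
Proof. by rewrite divr_gt0 ?pochhammer_gt0// ltr0n fact_gt0. Qed.

Lemma weightS k : weight k.+1 * (beta + k%:R) = k.+1%:R * weight k.
Proof.
rewrite /weight factS natrM pochhammerS; field.
by rewrite !gt_eqF ?pochhammer_gt0// ltr_wpDr// beta_gt0.
Qed.

Lemma sigma_sqr n : sg n ^+ 2 = (weight n)^-1.
Proof.
rewrite sqr_sqrtr; first by rewrite /weight invf_div.
by rewrite divr_ge0// ltW// pochhammer_gt0.
Qed.

Lemma sigma_gt0 n : 0 < sg n.
Proof. by rewrite sqrtr_gt0 divr_gt0 ?pochhammer_gt0// ltr0n fact_gt0. Qed.

Lemma sigma0 : sg 0 = 1.
Proof. by rewrite /sigma /pochhammer big_ord0 divr1 sqrtr1. Qed.

Lemma kersum_wide t n m K : (n < K)%N ->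
  kersum t n m = \sum_(k < K) weight k * binpow t n k * binpow t m k.
Proof.
move=> nK; rewrite /kersum.
rewrite -!(big_mkord xpredT (fun k => weight k * binpow t n k * binpow t m k)).
rewrite (big_cat_nat (leq0n _) nK)//= [X in _ = _ + X]big_nat_cond.
rewrite [X in _ = _ + X]big1 ?addr0// => k /andP[/andP[nk _] _].
by rewrite binpow_small// mulr0 mul0r.
Qed.

Lemma kersumC t n m : kersum t n m = kersum t m n.
Proof.
rewrite (@kersum_wide t n m (n + m).+1) ?ltnS ?leq_addr//.
rewrite (@kersum_wide t m n (n + m).+1) ?ltnS ?leq_addl//.
by apply: eq_bigr => k _; rewrite mulrAC.
Qed.

Lemma kerC t n m : ker t n m = ker t m n.
Proof. by rewrite /ker kersumC addnC [sg n * _]mulrC. Qed.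

(* The derivative of kersum is dsum + lsum; esum weights its terms by k.  The
   three sums and kersum satisfy linear relations that imply the heat equation. *)
Let dsum t n m : R :=
  \sum_(k < n.+1) weight k * (k.+1%:R * binpow t n k.+1) * binpow t m k.
Let lsum t n m : R :=
  \sum_(k < n.+1) weight k * binpow t n k * (k.+1%:R * binpow t m k.+1).
Let esum t n m : R :=
  \sum_(k < n.+1) weight k * binpow t n k * (k%:R * binpow t m k).

Lemma is_derive_kersum t n m :
  is_derive t 1 (fun s => kersum s n m) (dsum t n m + lsum t n m).
Proof.
pose h (k : 'I_n.+1) (s : R) := weight k * binpow s n k * binpow s m k.
pose dh (k : 'I_n.+1) := weight k * (k.+1%:R * binpow t n k.+1) * binpow t m k +
          weight k * binpow t n k * (k.+1%:R * binpow t m k.+1).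
have -> : (fun s => kersum s n m) = \sum_(k < n.+1) h k.
  by apply/funext => s; rewrite fct_sumE.
have -> : dsum t n m + lsum t n m = \sum_(k < n.+1) dh k by rewrite -big_split.
apply: is_derive_sum => k.
have -> : h k = (cst (weight k) * (fun s => binpow s n k)) * (fun s => binpow s m k).
  by apply/funext => s.
have d1 := is_derive_binpow t n k; have d2 := is_derive_binpow t m k.
apply: is_derive_eq; rewrite /dh /GRing.scale /= !fctE /=; ring.
Qed.

Lemma kersum_euler1 t n m : n%:R * kersum t n m = t * dsum t n m + esum t n m.
Proof.
rewrite /kersum /dsum /esum !mulr_sumr -big_split; apply: eq_bigr => k _ /=.
have h := binpow_euler t n k.
transitivity (weight k * (n%:R * binpow t n k) * binpow t m k); first by ring.
by rewrite h; ring.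
Qed.

Lemma kersum_euler2 t n m : m%:R * kersum t n m = t * lsum t n m + esum t n m.
Proof.
rewrite /kersum /lsum /esum !mulr_sumr -big_split; apply: eq_bigr => k _ /=.
have h := binpow_euler t m k.
transitivity (weight k * binpow t n k * (m%:R * binpow t m k)); first by ring.
by rewrite h; ring.
Qed.

Lemma kersum_down t n m : m.+1%:R * kersum t n m = lsum t n m.+1.
Proof.
rewrite /kersum /lsum mulr_sumr; apply: eq_bigr => k _.
by rewrite -binpow_absorb; ring.
Qed.

Lemma lsum0 t n : lsum t n 0 = 0.
Proof. by rewrite /lsum big1// => k _; rewrite (@binpow_small t 0 k.+1)// !mulr0. Qed.

(** Raising m splits binpow by Pascal's rule.  The term with k lowered by one is
    shifted back to k, and turns into dsum because the weights k!/(beta)_k satisfy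
    the recursion weightS. *)
Lemma kersum_up t n m : (m%:R + beta) * kersum t n m.+1 =
  t * (m%:R + beta) * kersum t n m + t * esum t n m + dsum t n m.
Proof.
have -> : kersum t n m.+1 = t * kersum t n m +
    \sum_(k < n) weight k.+1 * binpow t n k.+1 * binpow t m k.
  rewrite /kersum big_ord_recl [in RHS]big_ord_recl /= binpowS0.
  under eq_bigr do rewrite ?lift0 /bump /= ?add1n binpowSS mulrDr.
  rewrite big_split /= mulrDr addrA mulr_sumr; congr (_ + _ + _); first by ring.
  by apply: eq_bigr => k _; rewrite ?lift0 /bump /= ?add1n; ring.
have -> : dsum t n m = \sum_(k < n) (beta + k%:R) *
    (weight k.+1 * binpow t n k.+1 * binpow t m k).
  rewrite /dsum big_ord_recr /= (@binpow_small t n n.+1)// !(mulr0, mul0r) addr0.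
  apply: eq_bigr => k _; have h := weightS k.
  transitivity (k.+1%:R * weight k * binpow t n k.+1 * binpow t m k); first by ring.
  by rewrite -h; ring.
have -> : esum t n m = \sum_(k < n) k.+1%:R *
    (weight k.+1 * binpow t n k.+1 * binpow t m k.+1).
  rewrite /esum big_ord_recl mul0r mulr0 add0r; apply: eq_bigr => k _.
  by rewrite ?lift0 /bump /= ?add1n; ring.
rewrite [LHS]mulrDr -[RHS]addrA; congr (_ + _); first by ring.
rewrite !mulr_sumr -big_split; apply: eq_bigr => k _ /=.
have h := binpow_euler t m k.
transitivity (weight k.+1 * binpow t n k.+1 * (m%:R * binpow t m k) +
   beta * (weight k.+1 * binpow t n k.+1 * binpow t m k)); first by ring.
by rewrite h; ring.
Qed.

Definition rprev x n : R := if n is k.+1 then x k else 0.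
Definition offdiag n : R := Num.sqrt (n%:R * (n%:R + alpha)).

Definition rtau x n : R := - offdiag n * rprev x n
  + (2 * n%:R + 1 + alpha) * x n - offdiag n.+1 * x n.+1.

Lemma offdiag0 : offdiag 0 = 0.
Proof. by rewrite /offdiag mul0r sqrtr0. Qed.

Lemma sigmaS n : sg n.+1 ^+ 2 * n.+1%:R = sg n ^+ 2 * (n%:R + beta).
Proof.
rewrite !sigma_sqr; have h := weightS n.
apply: (mulfI (lt0r_neq0 (weight_gt0 n))); apply: (mulfI (lt0r_neq0 (weight_gt0 n.+1))).
have w1 := lt0r_neq0 (weight_gt0 n); have w2 := lt0r_neq0 (weight_gt0 n.+1).
transitivity (n.+1%:R * weight n); first by field.
by rewrite -h; field.
Qed.

Lemma nat_beta_gt0 n : 0 < n%:R + beta :> R.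
Proof. by rewrite ltr_wpDl// beta_gt0. Qed.

Lemma offdiag_sigma n : offdiag n.+1 * sg n.+1 = (n%:R + beta) * sg n.
Proof.
have nb := nat_beta_gt0 n.
apply/eqP; rewrite -(@eqrXn2 _ 2)//; last first.
- by rewrite mulr_ge0 ?(ltW (sigma_gt0 _)) ?ltW.
- by rewrite mulr_ge0 ?sqrtr_ge0 ?(ltW (sigma_gt0 _)).
rewrite !exprMn sqr_sqrtr; last first.
  by rewrite mulr_ge0// -natr1 -addrA [1 + _]addrC ltW.
have h := sigmaS n.
have -> : n.+1%:R + alpha = n%:R + beta by rewrite -natr1; ring.
apply/eqP; transitivity ((n%:R + beta) * (sg n.+1 ^+ 2 * n.+1%:R)); first by ring.
by rewrite h; ring.
Qed.

Lemma offdiag_sigma_down n : offdiag n.+1 * sg n = n.+1%:R * sg n.+1.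
Proof.
have h := offdiag_sigma n; have h2 := sigmaS n.
apply: (mulfI (lt0r_neq0 (nat_beta_gt0 n))).
apply: (mulfI (lt0r_neq0 (sigma_gt0 n))).
transitivity (offdiag n.+1 * (sg n ^+ 2 * (n%:R + beta))); first by ring.
rewrite -h2.
transitivity (sg n.+1 * n.+1%:R * (offdiag n.+1 * sg n.+1)); first by ring.
by rewrite h; ring.
Qed.

(** The constant function is harmonic for the birth-death chain with birth rates
    n + alpha + 1 and death rates n, whose generator is conjugate to -H. *)
Lemma rtau_sigma n : rtau sg n = 0.
Proof.
rewrite /rtau offdiag_sigma; case: n => [|n] /=.
  by rewrite offdiag0; ring.
by rewrite mulNr offdiag_sigma_down -natr1; ring.
Qed.

(** The heat equation.  It is checked in the variables kersum, dsum, lsum and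
    esum, where it reduces to the difference of the two Euler relations. *)
Lemma is_derive_ker t n m : -1 < t ->
  is_derive t 1 (fun s => ker s n m) (- rtau (ker t n) m).
Proof.
move=> t1; have t0 : 0 < 1 + t by rewrite -ltrBlDl sub0r.
pose r : R := - (beta + (n + m)%:R).
pose c := (1 + t) `^ (r - 1).
have powE j (q : R) : r - 1 + j%:R = q -> (1 + t) `^ q = (1 + t) ^+ j * c.
  move=> <-; rewrite powRD; first by rewrite powR_mulrn ?ltW// mulrC.
  by rewrite (gt_eqF t0) implybT.
have d1 : is_derive t 1 (fun s : R => (1 + s) `^ r) (r * c).
  have hd : is_derive (1 + t) 1 ((@powR R)^~ r) (r * c) by exact: is_derive1_powR.
  have hs : is_derive t 1 (fun s : R => 1 + s) 1.
    have -> : (fun s : R => 1 + s) = (cst 1 + @id R) by [].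
    by apply: is_derive_eq; rewrite add0r.
  by have := is_derive1_comp hd hs; rewrite mulr1.
have d2 := is_derive_kersum t n m.
have -> : (fun s => ker s n m) = cst (sg n * sg m) * ((fun s : R => (1 + s) `^ r) *
    (fun s => kersum s n m)) by apply/funext.
apply: is_derive_eq; rewrite /GRing.scale /= ?fctE /=.
have -> : (1 + t) `^ r = (1 + t) * c by rewrite (powE 1%N)// subrK.
have e1 := kersum_euler1 t n m; have e2 := kersum_euler2 t n m.
have up : offdiag m.+1 * ker t n m.+1 = sg n * sg m * c * ((m%:R + beta) * kersum t n m.+1).
  rewrite /ker (powE 0%N) ?expr0 ?mul1r; last by rewrite /r addnS -natr1; ring.
  transitivity (sg n * c * kersum t n m.+1 * (offdiag m.+1 * sg m.+1)); first by ring.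
  by rewrite offdiag_sigma; ring.
have down : offdiag m * rprev (ker t n) m = sg n * sg m * c * (1 + t) ^+ 2 * lsum t n m.
  have [m0|m0] := posnP m.
    have -> : rprev (ker t n) m = 0 by rewrite m0.
    have -> : lsum t n m = 0 by rewrite m0 lsum0.
    by rewrite !mulr0.
  have mE : m.-1.+1 = m by rewrite prednK.
  have mR : m%:R = m.-1%:R + 1 :> R by rewrite natr1 mE.
  have -> : rprev (ker t n) m = ker t n m.-1 by rewrite -[in LHS]mE.
  have -> : lsum t n m = m%:R * kersum t n m.-1.
    by have := kersum_down t n m.-1; rewrite mE.
  have od : offdiag m * sg m.-1 = m%:R * sg m.
    by have := offdiag_sigma_down m.-1; rewrite mE.
  rewrite /ker (powE 2%N); last by rewrite /r !natrD mR; ring.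
  transitivity (sg n * c * kersum t n m.-1 * (1 + t) ^+ 2 * (offdiag m * sg m.-1)); first by ring.
  by rewrite od; ring.
have dg : ker t n m = sg n * sg m * c * (1 + t) * kersum t n m.
  by rewrite /ker (powE 1%N) ?subrK// expr1; ring.
rewrite /rtau [- offdiag m * _]mulNr down up dg kersum_up /r natrD.
move: e1 e2; move: (kersum t n m) (dsum t n m) (lsum t n m) (esum t n m) => S D L E e1 e2.
have e3 : (m%:R - n%:R) * S + t * D - t * L = 0 by rewrite mulrBl e1 e2; ring.
apply/eqP; rewrite -subr_eq0; apply/eqP.
transitivity (sg n * sg m * c * ((m%:R - n%:R) * S + t * D - t * L)); last by rewrite e3 mulr0.
have eE : E = m%:R * S - t * L by rewrite e2; ring.
by rewrite eE; ring.
Qed.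

Lemma binpow0 n k : binpow 0 n k = (n == k)%:R.
Proof.
rewrite /binpow expr0n subn_eq0; have [nk|kn|->] := ltngtP n k.
- by rewrite bin_small// mul0r.
- by rewrite mulr0.
- by rewrite binn mulr1.
Qed.

Lemma ker0 n m : ker 0 n m = (n == m)%:R.
Proof.
rewrite /ker addr0 powR1 mul1r /kersum.
have -> : \sum_(k < n.+1) weight k * binpow 0 n k * binpow 0 m k =
    weight n * (n == m)%:R.
  rewrite big_ord_recr /= !binpow0 eqxx mulr1 big1 ?add0r 1?[m == n]eq_sym//.
  by move=> k _; rewrite binpow0 gtn_eqF// mulr0 mul0r.
have [->|nm] := eqVneq n m; last by rewrite mulr0 mulr0.
by rewrite mulr1 -expr2 sigma_sqr mulVf// gt_eqF// weight_gt0.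
Qed.

Lemma binpow_ge0 t n k : 0 <= t -> 0 <= binpow t n k.
Proof. by move=> t0; rewrite mulr_ge0// exprn_ge0. Qed.

Lemma sum_binpow t n : \sum_(k < n.+1) binpow t n k = (1 + t) ^+ n.
Proof.
rewrite addrC exprDn; apply: eq_bigr => k _.
by rewrite /binpow expr1n mulr1 mulr_natl.
Qed.

Lemma binpow_le t n k : 0 <= t -> binpow t n k <= (1 + t) ^+ n.
Proof.
move=> t0; have [nk|kn] := ltnP n k.
  by rewrite binpow_small// exprn_ge0// addr_ge0.
rewrite -sum_binpow (bigD1 (inord k : 'I_n.+1))//= inordK// lerDl.
by apply: sumr_ge0 => i _; exact: binpow_ge0.
Qed.

Lemma kersum_ge0 t n m : 0 <= t -> 0 <= kersum t n m.
Proof.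
move=> t0; apply: sumr_ge0 => k _; apply: mulr_ge0; last exact: binpow_ge0.
by apply: mulr_ge0; [exact: ltW (weight_gt0 k)|exact: binpow_ge0].
Qed.

Lemma ker_ge0 t n m : 0 <= t -> 0 <= ker t n m.
Proof.
move=> t0; apply: mulr_ge0; first by rewrite mulr_ge0// ltW// sigma_gt0.
by rewrite mulr_ge0 ?powR_ge0 ?kersum_ge0.
Qed.

(** After division by (1 + t)^(n+m) the sum is the expectation of weight over
    the event that two independent binomial variables are equal; for alpha >= 0
    the weights are at most 1, so that the sum is at most a probability. *)
Lemma ker_le t n m : 0 <= alpha -> 0 <= t ->
  ker t n m <= sg n * sg m * (1 + t) `^ (- beta).
Proof.
move=> a0 t0; rewrite ler_wpM2l ?mulr_ge0 ?(ltW (sigma_gt0 _))//.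
have t1 : 0 < 1 + t by rewrite ltr_wpDr.
have -> : (1 + t) `^ (- beta) = (1 + t) `^ (- (beta + (n + m)%:R)) * (1 + t) ^+ (n + m).
  rewrite -powR_mulrn ?(ltW t1)// -powRD; last by rewrite (gt_eqF t1) implybT.
  by congr (_ `^ _); ring.
rewrite ler_wpM2l ?powR_ge0// exprD -[X in _ <= X * _]sum_binpow mulr_suml.
apply: ler_sum => k _; rewrite ler_pM ?binpow_le ?binpow_ge0//.
  by rewrite mulr_ge0 ?binpow_ge0 ?(ltW (weight_gt0 _)).
apply: ler_piMl; first exact: binpow_ge0.
elim: (nat_of_ord k) => [|j IH].
  by rewrite /weight /pochhammer big_ord0 divr1.
have bj : 0 < beta + j%:R by rewrite ltr_wpDr ?beta_gt0.
rewrite -(ler_pM2r bj) weightS mul1r; apply: le_trans (_ : j.+1%:R <= _).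
  by rewrite ler_piMr.
by rewrite -natr1 addrC lerD2r lerDr.
Qed.

Lemma ker00 t : 0 <= t -> ker t 0 0 = (1 + t) `^ (- beta).
Proof.
move=> t0; rewrite /ker sigma0 !mul1r addr0 /kersum big_ord1.
by rewrite /weight /pochhammer /binpow big_ord0 bin0 divr1 expr0 !mulr1.
Qed.

End HeatKernel.

Section RightDerivative.
Variable R : realType.
Implicit Types (f g : R -> R) (s l a b e : R).
Local Open Scope classical_set_scope.

Definition rderiv f s l := h^-1 * (f (s + h) - f s) @[h --> 0^'+] --> l.
Definition lcont f s := f (s - h) @[h --> 0^'+] --> f s.

Lemma cvg_right0_id : (h @[h --> (0 : R)^'+] --> (0 : R)).
Proof. by apply: cvg_at_right_filter; exact: cvg_id. Qed.

Lemma near_right0 (P : R -> Prop) : (\forall h \near 0^'+, P h) ->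
  exists d : R, 0 < d /\ forall h, 0 < h < d -> P h.
Proof.
move=> [d /= d0 hd]; exists d; split=> // h /andP[h0 hd'].
by apply: hd => //=; rewrite sub0r normrN gtr0_norm.
Qed.

Lemma near_right0P (P : R -> Prop) (d : R) : 0 < d ->
  (forall h, 0 < h < d -> P h) -> \forall h \near 0^'+, P h.
Proof.
move=> d0 hd; exists d => //= h /=; rewrite sub0r normrN => hd' h0.
by apply: hd; rewrite h0 (le_lt_trans (ler_norm _)).
Qed.

Lemma rderiv_right_cont f s l : rderiv f s l -> f (s + h) @[h --> 0^'+] --> f s.
Proof.
move=> fl.
have : h * (h^-1 * (f (s + h) - f s)) + f s @[h --> 0^'+] --> 0 * l + f s.
  by apply: cvgD; [apply: cvgM => //; exact: cvg_right0_id|exact: cvg_cst].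
rewrite mul0r add0r; apply: cvg_trans; apply: near_eq_cvg.
near=> h; have h0 : h != 0 by rewrite gt_eqF//; near: h; exact: nbhs_right_gt.
by rewrite mulVKf// subrK.
Unshelve. all: by end_near. Qed.

Lemma rderivM f g s l k : rderiv f s l -> rderiv g s k ->
  rderiv (fun r => f r * g r) s (l * g s + f s * k).
Proof.
move=> fl gk.
have c : h^-1 * (f (s + h) - f s) * g (s + h) +
    f s * (h^-1 * (g (s + h) - g s)) @[h --> 0^'+] --> l * g s + f s * k.
  apply: cvgD; first by apply: cvgM => //; exact: rderiv_right_cont gk.
  by apply: cvgM => //; exact: cvg_cst.
apply: cvg_trans c; apply: near_eq_cvg; near=> h; ring.
Unshelve. all: by end_near. Qed.

Lemma rderivB f g s l k : rderiv f s l -> rderiv g s k ->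
  rderiv (fun r => f r - g r) s (l - k).
Proof.
move=> fl gk.
have c : h^-1 * (f (s + h) - f s) - h^-1 * (g (s + h) - g s) @[h --> 0^'+] --> l - k.
  exact: cvgB.
apply: cvg_trans c; apply: near_eq_cvg; near=> h; ring.
Unshelve. all: by end_near. Qed.

Lemma rderiv_sum N (f : nat -> R -> R) s (l : nat -> R) :
  (forall i, (i < N)%N -> rderiv (f i) s (l i)) ->
  rderiv (fun r => \sum_(i < N) f i r) s (\sum_(i < N) l i).
Proof.
move=> fl.
have c : \sum_(i < N) h^-1 * (f i (s + h) - f i s) @[h --> 0^'+] --> \sum_(i < N) l i.
  exact: (@cvg_fsum R R 0^'+ _ N (fun i h => h^-1 * (f i (s + h) - f i s)) l).
apply: cvg_trans c; apply: near_eq_cvg; near=> h.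
by rewrite -mulr_sumr sumrB.
Unshelve. all: by end_near. Qed.

Lemma rderiv_cst (c s : R) : rderiv (fun=> c) s 0.
Proof. by rewrite /rderiv subrr; under eq_cvg do rewrite mulr0; exact: cvg_cst. Qed.

Lemma lcont_cst (c s : R) : lcont (fun=> c) s.
Proof. exact: cvg_cst. Qed.

Lemma rderiv_is_derive f s l : is_derive s 1 f l -> rderiv f s l.
Proof.
move=> [fd <-]; have c : h^-1 *: ((f \o shift s) (h *: 1) - f s) @[h --> 0^'+] --> 'D_1 f s.
  by apply: cvg_dnbhs_at_right; exact: fd.
apply: cvg_trans c; apply: near_eq_cvg; near=> h.
by rewrite /= /GRing.scale /= mulr1 [h + s]addrC.
Unshelve. all: by end_near. Qed.

Lemma lcont_continuous f s : {for s, continuous f} -> lcont f s.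
Proof.
move=> fs; have c : s - h @[h --> 0^'+] --> s.
  by rewrite -[X in _ --> X]subr0; apply: cvgB; [exact: cvg_cst|exact: cvg_right0_id].
by apply: continuous_cvg.
Qed.

Lemma lcont_is_derive f s l : is_derive s 1 f l -> lcont f s.
Proof.
move=> [fd _]; apply: lcont_continuous; apply: differentiable_continuous.
exact/derivable1_diffP.
Qed.

Lemma right_derive_bound f (f' : R -> R) a b e : a <= b -> 0 <= e ->
  (forall s, a < s <= b -> lcont f s) ->
  (forall s, a <= s < b -> rderiv f s (f' s)) ->
  (forall s, a <= s < b -> `|f' s| <= e) ->
  `|f b - f a| <= e * (b - a).
Proof.
move=> ab e0 lc rd f'e; apply: right_slope_le => // s eta hs eta0.
  have /cvgrPdist_le/(_ _ eta0)/near_right0 [d [d0 hd]] := lc s hs.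
  by exists d; split=> // h hh _; exact: hd.
have /cvgrPdist_le/(_ _ eta0)/near_right0 [d [d0 hd]] := rd s hs.
exists d; split=> // h hh _; have h0 : 0 < h by case/andP: hh.
have := hd h hh; rewrite distrC => h1.
have : `|h^-1 * (f (s + h) - f s)| <= e + eta.
  rewrite -[X in `|X|](subrK (f' s)) addrC.
  by apply: le_trans (ler_normD _ _) _; rewrite lerD// f'e.
by rewrite normrM gtr0_norm ?invr_gt0// ler_pdivrMl// mulrC.
Qed.

End RightDerivative.

(** * Decay of the kernel and Duhamel's principle *)

(** One factor m + 1 is absorbed at a time, by writing a as the square of b and
    comparing (m + 1) b^m with the geometric series of b. *)
Lemma poly_geom_bound (R : realType) K (a : R) : 0 <= a < 1 ->
  exists C : R, forall m, m.+1%:R ^+ K * a ^+ m <= C.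
Proof.
elim: K a => [|K IH] a /andP[a0 a1].
  by exists 1 => m; rewrite mul1r exprn_ile1// ltW.
set b := Num.sqrt a; have b0 : 0 <= b by exact: sqrtr_ge0.
have b1 : b < 1 by rewrite -(sqrtr1 R) ltr_sqrt.
have [C hC] := IH b (introT andP (conj b0 b1)).
exists (C * (1 - b)^-1) => m.
have -> : m.+1%:R ^+ K.+1 * a ^+ m = (m.+1%:R ^+ K * b ^+ m) * (m.+1%:R * b ^+ m).
  by rewrite -(sqr_sqrtr a0) -/b exprS -exprM mulnC exprM expr2; ring.
apply: ler_pM => //; try by rewrite mulr_ge0 ?exprn_ge0.
have b1' : 0 < 1 - b by rewrite subr_gt0.
rewrite -[(1 - b)^-1]mul1r ler_pdivlMr//.
have : \sum_(i < m.+1) b ^+ m <= \sum_(i < m.+1) b ^+ i.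
  apply: ler_sum => i _; apply: ler_wiXn2l => //; first exact: ltW.
  by rewrite -ltnS.
rewrite sumr_const card_ord -[b ^+ m *+ _]mulr_natl => h.
apply: le_trans (_ : (\sum_(i < m.+1) b ^+ i) * (1 - b) <= _).
  exact: (ler_wpM2r (ltW b1') h).
have := subrX1 b m.+1 => h2.
have -> : (\sum_(i < m.+1) b ^+ i) * (1 - b) = 1 - b ^+ m.+1.
  by rewrite -[RHS]opprB h2; ring.
by rewrite gerBl exprn_ge0.
Qed.

Lemma poly_geom_small (R : realType) K (a C e : R) : 0 <= a < 1 -> 0 < e ->
  exists M0, forall m, (M0 <= m)%N -> C * m.+1%:R ^+ K * a ^+ m <= e.
Proof.
move=> a01 e0; have [B hB] := poly_geom_bound K.+1 a01.
have B0 : 0 <= B.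
  by apply: le_trans (hB 0%N); rewrite expr1n mul1r expr0.
exists (Num.trunc (`|C| * B / e)) => m hm.
apply: le_trans (_ : `|C| * (m.+1%:R ^+ K * a ^+ m) <= _).
  rewrite -mulrA ler_wpM2r ?ler_norm// mulr_ge0 ?exprn_ge0//.
  by case/andP: a01.
have m0 : 0 < m.+1%:R :> R by [].
rewrite -(ler_pM2l m0).
have -> : m.+1%:R * (`|C| * (m.+1%:R ^+ K * a ^+ m)) =
    `|C| * (m.+1%:R ^+ K.+1 * a ^+ m) by rewrite exprS; ring.
apply: le_trans (_ : `|C| * B <= _); first by rewrite ler_wpM2l.
rewrite -ler_pdivrMr//; apply: le_trans (ltW (truncnS_gt _)) _.
by rewrite ler_nat.
Qed.

Section Variation.
Variables (R : realType) (alpha : R).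
Hypothesis alphaN1 : -1 < alpha.
Implicit Types (s t : R) (n m k d : nat).
Local Notation beta := (alpha + 1).
Local Notation sg := (sigma alpha).
Local Notation ker := (heat_kernel alpha).
Local Notation rtau := (rtau alpha).
Local Notation offdiag := (offdiag alpha).

(** sigma_m^2 is of order m^alpha; an integer exponent suffices here. *)
Lemma sigma_poly : exists d, forall m, sg m <= m.+1%:R ^+ d.
Proof.
pose b := Num.trunc beta; have hb : beta < b.+1%:R by exact: truncnS_gt.
exists b.+1 => m.
(* the first two terms of the binomial expansion *)
have bern (y : R) j : 0 <= y -> y ^+ j.+1 + j.+1%:R * y ^+ j <= (y + 1) ^+ j.+1.
  move=> y0; elim: j => [|j IH]; first by rewrite !expr1 expr0 mulr1.
  rewrite [leRHS]exprS; apply: le_trans (ler_wpM2l _ IH); last by rewrite addr_ge0.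
  rewrite -subr_ge0 -[j.+2%:R]natr1 !exprS.
  have -> : (y + 1) * (y * y ^+ j + j.+1%:R * y ^+ j) -
     (y * (y * y ^+ j) + (j.+1%:R + 1) * (y * y ^+ j)) = j.+1%:R * y ^+ j by ring.
  by rewrite mulr_ge0 ?exprn_ge0.
have h : sg m ^+ 2 <= m.+1%:R ^+ b.+1.
  rewrite sigma_sqr//; elim: m => [|m IH].
    by rewrite /weight /pochhammer big_ord0 divr1 invr1 expr1n.
  have m1 : 0 < m.+1%:R :> R by [].
  have bm := nat_beta_gt0 alphaN1 m.
  have wS : (weight alpha m.+1)^-1 = (m%:R + beta) / m.+1%:R * (weight alpha m)^-1.
    have h := weightS alphaN1 m; have w0 := lt0r_neq0 (weight_gt0 alphaN1 m).
    have w1 := lt0r_neq0 (weight_gt0 alphaN1 m.+1).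
    apply: (mulfI w1); rewrite divff//.
    transitivity ((weight alpha m.+1 * (beta + m%:R)) / (m.+1%:R * weight alpha m)).
      by rewrite h divff// mulf_neq0// pnatr_eq0.
    field; rewrite w0 /= ?natr1 ?nat1r ?pnatr_eq0//.
  rewrite wS; apply: le_trans (ler_wpM2l _ IH) _; first by rewrite divr_ge0// ltW.
  have := bern m.+1%:R b (ler0n _ _); rewrite natr1; apply: le_trans.
  rewrite exprS mulrA divfK ?gt_eqF// -mulrDl ler_wpM2r ?exprn_ge0//.
  by rewrite lerD ?ler_nat// ltW.
have s0 := ltW (sigma_gt0 alphaN1 m).
have [s1|s1] := leP (sg m) 1.
  by apply: le_trans s1 _; rewrite exprn_ege1// ler1n.
by apply: le_trans h; rewrite expr2 ler_peMr// ltW.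
Qed.

(** A coefficient of a polynomial with nonnegative coefficients is bounded by the
    value of the polynomial at z. *)
Lemma binpow_geom_le s m k (z : R) : 0 <= s -> 0 < z ->
  binpow s m k * z ^+ k <= (s + z) ^+ m.
Proof.
move=> s0 z0; have [mk|km] := ltnP m k.
  by rewrite binpow_small// mul0r exprn_ge0// addr_ge0// ltW.
rewrite exprDn (bigD1 (inord k : 'I_m.+1))//= inordK// /binpow -mulrA mulr_natl lerDl.
by apply: sumr_ge0 => i _; rewrite mulrn_wge0// mulr_ge0 ?exprn_ge0 ?(ltW z0).
Qed.

(** Geometric decay of the rows of the kernel, uniform for bounded times.  It
    makes the boundary terms of all summations by parts below disappear. *)
Lemma ker_geom n (T : R) : 0 <= T -> exists (C a : R) d, [/\ 0 <= a < 1, 0 <= C &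
  forall s m, 0 <= s <= T -> ker s n m <= C * m.+1%:R ^+ d * a ^+ m].
Proof.
move=> T0; have [d hd] := sigma_poly.
(* for z < 1 the ratio (s + z) / (1 + s) is less than 1 and increases with s *)
pose z : R := 2^-1; have z0 : 0 < z by rewrite invr_gt0.
pose a := (T + z) / (1 + T).
have T1 : 0 < 1 + T by rewrite ltr_wpDr.
have z1 : z < 1 by rewrite invf_lt1// ltr1n.
have a0 : 0 <= a by rewrite divr_ge0 ?addr_ge0// ltW.
pose W := \sum_(k < n.+1) weight alpha k * (z ^+ k)^-1.
have W0 : 0 <= W.
  apply: sumr_ge0 => k _; rewrite mulr_ge0 ?invr_ge0 ?exprn_ge0 ?(ltW z0)//.
  exact: ltW (weight_gt0 alphaN1 k).
have sn := sigma_gt0 alphaN1 n.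
exists (sg n * W), a, d; split.
- by rewrite a0 /a ltr_pdivrMr// mul1r addrC ltrD2r.
- by rewrite mulr_ge0// ltW.
move=> s m /andP[s0 sT]; rewrite /heat_kernel.
have s1 : 0 < 1 + s by rewrite ltr_wpDr.
have -> : sg n * W * m.+1%:R ^+ d * a ^+ m = sg n * (m.+1%:R ^+ d) * (a ^+ m * W) by ring.
have k0 := kersum_ge0 alphaN1 n m s0.
apply: ler_pM.
- by rewrite mulr_ge0 ?(ltW (sigma_gt0 alphaN1 _)).
- by rewrite mulr_ge0 ?powR_ge0.
- by rewrite ler_wpM2l ?(ltW sn).
have -> : (1 + s) `^ (- (beta + (n + m)%:R)) =
    (1 + s) `^ (- beta) * ((1 + s) ^- n * (1 + s) ^- m).
  rewrite opprD powRD; last by rewrite (gt_eqF s1) implybT.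
  by rewrite powR_invn ?(ltW s1)// exprD invfM.
apply: le_trans (_ : ((1 + s) ^- n * (1 + s) ^- m) * kersum alpha s n m <= _).
  rewrite ler_wpM2r// ler_piMl ?mulr_ge0 ?invr_ge0 ?exprn_ge0 ?(ltW s1)//.
  rewrite powRN invf_le1 ?powR_gt0// -[X in X <= _](powRr0 (1 + s)).
  by rewrite ler_powR ?lerDl// ltW// beta_gt0.
rewrite /kersum !mulr_sumr; apply: ler_sum => k _.
have wk := weight_gt0 alphaN1 k.
have h1 : (1 + s) ^- n * binpow s n k <= 1.
  by rewrite ler_pdivrMl ?exprn_gt0// mulr1 binpow_le.
have h2 : (1 + s) ^- m * binpow s m k <= a ^+ m * (z ^+ k)^-1.
  rewrite -(ler_pM2r (exprn_gt0 k z0)) divfK ?gt_eqF ?exprn_gt0// -mulrA.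
  rewrite ler_pdivrMl ?exprn_gt0// -exprMn.
  apply: le_trans (binpow_geom_le _ _ s0 z0) _.
  apply: lerXn2r; rewrite ?nnegrE.
  - exact: addr_ge0 s0 (ltW z0).
  - exact: mulr_ge0 (ltW s1) a0.
  rewrite /a mulrA ler_pdivlMr// -subr_ge0.
  have -> : (1 + s) * (T + z) - (s + z) * (1 + T) = (1 - z) * (T - s) by ring.
  by rewrite mulr_ge0 ?subr_ge0// ltW.
have b1 : 0 <= (1 + s) ^- n * binpow s n k.
  by rewrite mulr_ge0 ?binpow_ge0 ?invr_ge0 ?exprn_ge0 ?(ltW s1).
have b2 : 0 <= (1 + s) ^- m * binpow s m k.
  by rewrite mulr_ge0 ?binpow_ge0 ?invr_ge0 ?exprn_ge0 ?(ltW s1).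
have -> : (1 + s) ^- n * (1 + s) ^- m * (weight alpha k * binpow s n k * binpow s m k) =
   weight alpha k * (((1 + s) ^- n * binpow s n k) * ((1 + s) ^- m * binpow s m k)) by ring.
have -> : a ^+ m * (weight alpha k * (z ^+ k)^-1) = weight alpha k * (1 * (a ^+ m * (z ^+ k)^-1)).
  by ring.
by rewrite ler_wpM2l ?(ltW wk)//; apply: ler_pM.
Qed.

Lemma ker_decay n d (T e : R) : 0 <= T -> 0 < e -> exists M0, forall m s,
  (M0 <= m)%N -> 0 <= s <= T -> m.+1%:R ^+ d * ker s n m <= e.
Proof.
move=> T0 e0; have [C [a [d' [a01 C0 h]]]] := ker_geom n T0.
have [M0 hM] := poly_geom_small (d + d') C a01 e0.
exists M0 => m s hm hs; apply: le_trans (hM m hm).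
apply: le_trans (ler_wpM2l _ (h s m hs)) _; first by rewrite exprn_ge0.
by rewrite exprD le_eqVlt; apply/orP; left; apply/eqP; ring.
Qed.

Lemma offdiag_le m : offdiag m <= m%:R + beta.
Proof.
have mb := nat_beta_gt0 alphaN1 m.
case: m mb => [|m] mb; first by rewrite offdiag0 ltW.
have mb' : 0 <= m.+1%:R + alpha by rewrite -natr1 -addrA [1 + _]addrC ltW// nat_beta_gt0.
rewrite -ler_sqr ?nnegrE ?sqrtr_ge0 ?(ltW mb)// sqr_sqrtr; last exact: mulr_ge0.
rewrite expr2; apply: ler_pM => //.
  by rewrite lerDl ltW// beta_gt0.
by rewrite lerD2l lerDl.
Qed.

(** Summation by parts: the truncation of the symmetry of tau leaves one
    boundary term. *)
Lemma rtau_green (x y : nat -> R) M :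
  \sum_(m < M.+1) (rtau x m * y m - x m * rtau y m) =
  offdiag M.+1 * (x M * y M.+1 - x M.+1 * y M).
Proof.
elim: M => [|M IH].
  by rewrite big_ord1 /rtau /= offdiag0; ring.
by rewrite big_ord_recr /= IH /rtau /=; ring.
Qed.

Lemma rtau_lin (c : R) (x y : nat -> R) m :
  rtau (fun i => c * x i + y i) m = c * rtau x m + rtau y m.
Proof. by rewrite /rtau; case: m => [|m] /=; ring. Qed.

Lemma rtau_sum N (z : nat -> R) (x : nat -> nat -> R) m :
  rtau (fun i => \sum_(n < N) z n * x n i) m = \sum_(n < N) z n * rtau (x n) m.
Proof.
elim: N => [|N IH].
  rewrite big_ord0 /rtau; under eq_fun do rewrite big_ord0.
  by case: m => [|m] /=; rewrite !big_ord0; ring.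
rewrite big_ord_recr /= -IH addrC -rtau_lin; congr (rtau _ _); apply/funext => i.
by rewrite big_ord_recr addrC.
Qed.

(** Rows of the kernel are tested against a finitely supported vector z, since
    norms in l^2 are controlled by duality. *)
Definition test_ker (z : nat -> R) N t m := \sum_(n < N) z n * ker t n m.

Lemma is_derive_test_ker z N t m : -1 < t ->
  is_derive t 1 (fun s => test_ker z N s m) (- rtau (test_ker z N t) m).
Proof.
move=> t1.
have -> : (fun s => test_ker z N s m) = \sum_(n < N) (cst (z n) * (fun s => ker s n m)).
  by apply/funext => s; rewrite fct_sumE.
have -> : - rtau (test_ker z N t) m = \sum_(n < N) (z n * - rtau (ker t n) m).
  by rewrite rtau_sum -sumrN; apply: eq_bigr => n _; rewrite mulrN.
apply: is_derive_sum => n.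
have d1 := is_derive_ker alphaN1 n m t1.
by apply: is_derive_eq; rewrite /GRing.scale /= mulr0 addr0.
Qed.

Lemma test_ker_decay z N d (T e : R) : 0 <= T -> 0 < e -> exists M0, forall m s,
  (M0 <= m)%N -> 0 <= s <= T -> m.+1%:R ^+ d * `|test_ker z N s m| <= e.
Proof.
move=> T0; elim: N e => [|N IH] e e0.
  by exists 0%N => m s _ _; rewrite /test_ker big_ord0 normr0 mulr0 ltW.
have [M1 h1] := IH _ (divr_gt0 e0 (ltr0Sn R 1)).
have zN : 0 < `|z N| + 1 by rewrite ltr_wpDl.
have [M2 h2] := ker_decay N d T0 (divr_gt0 (divr_gt0 e0 (ltr0Sn R 1)) zN).
exists (maxn M1 M2) => m s; rewrite geq_max => /andP[m1 m2] hs.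
have k0 : 0 <= ker s N m by apply: ker_ge0 => //; case/andP: hs.
rewrite /test_ker big_ord_recr /=.
apply: le_trans (ler_wpM2l _ (ler_normD _ _)) _; first by rewrite exprn_ge0.
rewrite mulrDr (splitr e) lerD ?h1// normrM (ger0_norm k0).
have := h2 m s m2 hs; rewrite ler_pdivlMr// => h; apply: le_trans h.
rewrite mulrCA [leRHS]mulrC; apply: ler_wpM2r; last by rewrite lerDl.
by apply: mulr_ge0 => //; exact: exprn_ge0.
Qed.

(** Duhamel's principle for a coordinatewise solution of y' = rho - tau y of
    polynomial growth: s |-> sum_m Z_{T-s}(m) y_m(s) has derivative
    sum_m Z_{T-s}(m) rho_m(s), up to a boundary term that decays uniformly. *)
Lemma kernel_variation (z : nat -> R) N d (T K : R) (y rho : R -> nat -> R) :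
  0 < T ->
  (forall s m, 0 <= s < T -> rderiv (y ^~ m) s (rho s m - rtau (y s) m)) ->
  (forall s m, 0 < s <= T -> lcont (y ^~ m) s) ->
  (forall s m, 0 <= s <= T -> `|y s m| <= K * m.+1%:R ^+ d) ->
  forall e, 0 < e -> exists M0, forall M (kappa B : R), (M0 <= M)%N ->
  (forall s, 0 <= s < T ->
     `|\sum_(m < M.+1) test_ker z N (T - s) m * rho s m - kappa| <= B) ->
  `|\sum_(m < M.+1) test_ker z N 0 m * y T m
    - \sum_(m < M.+1) test_ker z N T m * y 0 m - kappa * T| <= (B + e) * T.
Proof.
move=> T0 yd yc yb e e0; have T0' := ltW T0.
pose c := 2 * (K + 1) * (beta + 1) * 2 ^+ d.+1.
have b0 : 0 < beta by exact: beta_gt0.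
have K0 : 0 <= K.
  have : `|y 0 0%N| <= K * 1%:R ^+ d by apply: yb; rewrite lexx T0'.
  by rewrite expr1n mulr1; apply: le_trans.
have c0 : 0 < c by rewrite !mulr_gt0 ?exprn_gt0 ?ltr_wpDl ?(ltW b0).
have [M0 hM0] := test_ker_decay z N d.+1 T0' (divr_gt0 e0 c0).
exists M0 => M kappa B hM hB.
pose Z s m := test_ker z N s m.
pose phi s := \sum_(m < M.+1) Z (T - s) m * y s m - kappa * s.
pose dphi s := \sum_(m < M.+1) Z (T - s) m * rho s m - kappa +
  offdiag M.+1 * (Z (T - s) M * y s M.+1 - Z (T - s) M.+1 * y s M).
have Zd s m : 0 <= s <= T -> is_derive s 1 (fun r => Z (T - r) m) (rtau (Z (T - s)) m).
  move=> /andP[s0 sT].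
  have Ts : -1 < T - s by apply: lt_le_trans (_ : 0 <= _); rewrite ?ltrN10// subr_ge0.
  have h1 := is_derive_test_ker z N m Ts.
  have h2 : is_derive s 1 (fun r : R => T - r) (-1).
    have -> : (fun r : R => T - r) = cst T - @id R by [].
    by apply: is_derive_eq; rewrite sub0r.
  by have := @is_derive1_comp R (fun u => test_ker z N u m) (fun r => T - r) s _ _ h1 h2;
    rewrite mulrN1 opprK.
have boundary s : 0 <= s <= T ->
    `|offdiag M.+1 * (Z (T - s) M * y s M.+1 - Z (T - s) M.+1 * y s M)| <= e.
  move=> hs; have hTs : 0 <= T - s <= T.
    by case/andP: hs => s0 sT; rewrite subr_ge0 sT gerBl s0.
  have o0 : 0 <= offdiag M.+1 by exact: sqrtr_ge0.
  have z1 := hM0 M (T - s) hM hTs; have z2 := hM0 M.+1 (T - s) (leq_trans hM (leqnSn _)) hTs.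
  have y1 := yb s M.+1 hs; have y2 := yb s M hs.
  have oM : offdiag M.+1 <= (beta + 1) * M.+1%:R.
    apply: le_trans (offdiag_le _) _; rewrite mulrDl mul1r addrC lerD2r.
    by rewrite ler_peMr ?(ltW b0)// ler1n.
  have M2 : M.+2%:R <= 2 * M.+1%:R :> R by rewrite -natrM ler_nat mul2n -addnn addSnnS leq_addl.
  have M1 : 0 <= M.+1%:R :> R by [].
  rewrite normrM (ger0_norm o0).
  apply: le_trans (ler_wpM2l o0 (ler_normB _ _)) _; rewrite !normrM.
  have e2 : e = 2^-1 * e + 2^-1 * e by rewrite -mulrDl -[2^-1]mul1r -splitr mul1r.
  (* each of the two products is at most e / 2; P is M + 1 or M + 2 *)
  have half (P W Y : R) : 0 <= P -> 0 <= W -> 0 <= Y -> offdiag M.+1 <= (beta + 1) * P ->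
      Y <= K * (2 ^+ d * P ^+ d) -> P ^+ d.+1 * W <= e / c ->
      offdiag M.+1 * (W * Y) <= 2^-1 * e.
    move=> P0 W0 Y0 oP YP PW.
    apply: le_trans (_ : (beta + 1) * P * (W * (K * (2 ^+ d * P ^+ d))) <= _).
      by apply: ler_pM => //; [exact: mulr_ge0|exact: ler_wpM2l].
    have -> : (beta + 1) * P * (W * (K * (2 ^+ d * P ^+ d))) =
        (beta + 1) * (K * 2 ^+ d) * (P ^+ d.+1 * W) by rewrite exprS; ring.
    have bb : 0 <= beta + 1 by rewrite addr_ge0// ltW.
    have Kd : 0 <= K * 2 ^+ d by rewrite mulr_ge0 ?exprn_ge0.
    apply: le_trans (ler_wpM2l (mulr_ge0 bb Kd) PW) _.
    rewrite mulrA ler_pdivrMr// -subr_ge0.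
    have -> : 2^-1 * e * c - (beta + 1) * (K * 2 ^+ d) * e =
        e * (beta + 1) * 2 ^+ d * (K + 2) by rewrite /c exprS; field.
    by rewrite !mulr_ge0 ?exprn_ge0 ?(ltW e0)// addr_ge0.
  rewrite mulrDr e2; apply: lerD.
    apply: (half M.+1%:R) => //; apply: le_trans y1 _; apply: ler_wpM2l => //.
    by rewrite -exprMn; apply: lerXn2r; rewrite ?nnegrE ?mulr_ge0.
  apply: (half M.+2%:R) => //.
    by apply: le_trans oM _; rewrite ler_wpM2l ?ler_nat// addr_ge0// ltW.
  apply: le_trans y2 _; apply: ler_wpM2l => //; rewrite -exprMn.
  apply: lerXn2r; rewrite ?nnegrE ?mulr_ge0//.
  by rewrite -natrM ler_nat mul2n -addnn; apply: leq_trans (leqnSn _) (leq_addr _ _).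
have dB s : 0 <= s < T -> `|dphi s| <= B + e.
  move=> hs; apply: le_trans (ler_normD _ _) _; apply: lerD; first exact: hB.
  by apply: boundary; case/andP: hs => -> /ltW ->.
have := @right_derive_bound R phi dphi 0 T (B + e) T0' _ _ _ dB.
rewrite /phi !subr0 subrr mulr0 subr0 => H.
have -> : \sum_(m < M.+1) test_ker z N 0 m * y T m -
  \sum_(m < M.+1) test_ker z N T m * y 0 m - kappa * T =
  \sum_(m < M.+1) Z 0 m * y T m - kappa * T - \sum_(m < M.+1) Z T m * y 0 m by rewrite addrAC.
apply: H.
- by apply: le_trans (normr_ge0 (dphi 0)) (dB 0 _); rewrite lexx.
- move=> s hs; have hs' : 0 <= s <= T by case/andP: hs => /ltW -> ->.
  apply: cvgB.
    apply: (@cvg_fsum _ _ _ _ M.+1 (fun m h => Z (T - (s - h)) m * y (s - h) m)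
       (fun m => Z (T - s) m * y s m)) => m _.
    by apply: cvgM; [exact: lcont_is_derive (Zd s m hs')|exact: yc].
  apply: cvgM; first exact: cvg_cst.
  rewrite -[X in (_ --> X)%classic]subr0; apply: cvgB; first exact: cvg_cst.
  exact: cvg_right0_id.
- move=> s hs; have hs' : 0 <= s <= T by case/andP: hs => -> /ltW ->.
  have -> : dphi s = \sum_(m < M.+1) (rtau (Z (T - s)) m * y s m +
      Z (T - s) m * (rho s m - rtau (y s) m)) - kappa.
    rewrite /dphi -rtau_green addrAC -big_split /=; congr (_ - _).
    by apply: eq_bigr => m _; ring.
  apply: rderivB.
    apply: (@rderiv_sum _ M.+1 (fun m r => Z (T - r) m * y r m) s
      (fun m => rtau (Z (T - s)) m * y s m + Z (T - s) m * (rho s m - rtau (y s) m))) => m _.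
    apply: rderivM (yd s m hs); exact: rderiv_is_derive (Zd s m hs').
  have hid : rderiv (fun r : R => r) s 1 by apply: rderiv_is_derive; exact: is_derive_id.
  by have := rderivM (rderiv_cst kappa s) hid; rewrite mul0r add0r mulr1.
Qed.

End Variation.

(** * The heat semigroup on real sequences *)

Section RealHeat.
Variables (R : realType) (alpha : R).
Hypothesis alphaN1 : -1 < alpha.
Implicit Types (s t h : R) (n m k d : nat) (x y : nat -> R).
Local Notation beta := (alpha + 1).
Local Notation sg := (sigma alpha).
Local Notation ker := (heat_kernel alpha).
Local Notation rtau := (rtau alpha).
Local Notation l2 x := (exists a : R, l2le x a).
Local Notation delta n := (fun i : nat => (i == n)%:R : R).

Lemma sum_delta n M (f : nat -> R) : (n < M)%N ->
  \sum_(i < M) (i == n :> nat)%:R * f i = f n.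
Proof.
move=> nM; rewrite (bigD1 (Ordinal nM))//= eqxx mul1r big1 ?addr0// => i.
by rewrite -val_eqE /= => /negPf ->; rewrite mul0r.
Qed.

Lemma sum_vanish (f : nat -> R) M N : (M <= N)%N ->
  (forall i, (M <= i)%N -> f i = 0) -> \sum_(i < N) f i = \sum_(i < M) f i.
Proof.
move=> MN f0; rewrite -!(big_mkord xpredT f) (big_cat_nat (leq0n _) MN)//=.
by rewrite [X in _ + X]big_nat_cond [X in _ + X]big1 ?addr0// => i /andP[/andP[/f0]].
Qed.

Lemma dot_fin x y M : (forall i, (M <= i)%N -> x i * y i = 0) ->
  dot x y = \sum_(i < M) x i * y i.
Proof.
move=> h; apply: cvg_lim => //.
apply: cvg_near_cst; near=> N; rewrite -sum_series.
apply: (sum_vanish (f := fun i => x i * y i)) => //.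
by near: N; exact: nbhs_infty_ge.
Unshelve. all: by end_near. Qed.

Lemma dot_unique x y l a b : l2le x a -> l2le y b ->
  (\sum_(i < N) x i * y i @[N --> \oo] --> l)%classic -> dot x y = l.
Proof.
move=> xa yb h; have d := dot_cvg xa yb.
by rewrite -(cvg_lim _ h)// (cvg_lim _ d).
Qed.

Lemma dotC x y : dot x y = dot y x.
Proof. by rewrite /dot; congr (limn (series _)); apply/funext => i; rewrite mulrC. Qed.

Lemma dot_lin x y y' c : l2 x -> l2 y -> l2 y' ->
  dot x (fun i => c * y i + y' i) = c * dot x y + dot x y'.
Proof.
move=> [a xa] [b yb] [b' yb']; apply: (dot_unique xa (l2leD (l2leZ c yb) yb')).
have h : (c * (\sum_(i < N) x i * y i) + \sum_(i < N) x i * y' i @[N --> \oo]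
    --> c * dot x y + dot x y')%classic.
  apply: cvgD; last exact: dot_cvg xa yb'.
  by apply: cvgM; [exact: cvg_cst|exact: dot_cvg xa yb].
apply: cvg_trans h; apply: near_eq_cvg; near=> N.
by rewrite mulr_sumr -big_split /=; apply: eq_bigr => i _; ring.
Unshelve. all: by end_near. Qed.

Lemma l2_lin x y c : l2 x -> l2 y -> l2 (fun i => c * x i + y i).
Proof. by move=> [a xa] [b yb]; exists (`|c| * a + b); apply: l2leD => //; exact: l2leZ. Qed.

Lemma dot_sum x M (c : nat -> R) (y : nat -> nat -> R) : l2 x ->
  (forall j, l2 (y j)) ->
  l2 (fun i => \sum_(j < M) c j * y j i) /\
  dot x (fun i => \sum_(j < M) c j * y j i) = \sum_(j < M) c j * dot x (y j).
Proof.
move=> xl yl; elim: M => [|M [IH1 IH2]].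
  have -> : (fun i => \sum_(j < 0) c j * y j i) = (fun=> 0 : R).
    by apply/funext => i; rewrite big_ord0.
  split; first by exists 0; exact: l2le0.
  by rewrite (@dot_fin _ _ 0%N) ?big_ord0 ?big_ord0// => i _; rewrite mulr0.
have -> : (fun i => \sum_(j < M.+1) c j * y j i) =
    (fun i => c M * y M i + \sum_(j < M) c j * y j i).
  by apply/funext => i; rewrite big_ord_recr addrC.
split; first exact: l2_lin.
by rewrite dot_lin// IH2 big_ord_recr addrC.
Qed.

(** A coordinatewise solution of y' = - tau y of polynomial growth is determined
    by its initial value.  This one uniqueness statement yields the invariance of
    sigma, the semigroup law and the uniqueness of the semigroup. *)
Lemma kernel_trajectory n d (T K : R) (y : R -> nat -> R) : 0 < T ->
  (forall s m, 0 <= s < T -> rderiv (y ^~ m) s (- rtau (y s) m)) ->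
  (forall s m, 0 < s <= T -> lcont (y ^~ m) s) ->
  (forall s m, 0 <= s <= T -> `|y s m| <= K * m.+1%:R ^+ d) ->
  (\sum_(m < M) ker T n m * y 0 m @[M --> \oo] --> y T n)%classic.
Proof.
move=> T0 yd yc yb; apply/cvgrPdist_le => e e0.
have eT : 0 < e / T by rewrite divr_gt0.
have yd' s m : 0 <= s < T -> rderiv (y ^~ m) s (0 - rtau (y s) m) by rewrite sub0r; exact: yd.
have [M0 hM0] := kernel_variation alphaN1 (delta n) n.+1 (rho := fun _ _ => 0)
  T0 yd' yc yb eT.
have ZE t m : test_ker alpha (delta n) n.+1 t m = ker t n m.
  by rewrite /test_ker (@sum_delta n n.+1 (fun i => ker t i m)).
exists (maxn M0 n).+1 => //= -[//|M]; rewrite /= ltnS geq_max => /andP[M0M nM].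
have := hM0 M 0 0 M0M; rewrite add0r divfK ?gt_eqF// mul0r subr0.
under [X in `|X - _|]eq_bigr do rewrite ZE ker0// eq_sym.
under [X in `|_ - X|]eq_bigr do rewrite ZE.
rewrite (@sum_delta n M.+1)//; apply=> s _.
by rewrite big1 ?subrr ?normr0// => i _; rewrite mulr0.
Qed.

(** The constant solution sigma of the heat equation gives equality for the full
    series, and the terms are nonnegative. *)
Lemma ker_sigma_sum t n M : 0 <= t -> \sum_(m < M) ker t n m * sg m <= sg n.
Proof.
move=> t0; have s0 m := ltW (sigma_gt0 alphaN1 m).
have mono : {homo (fun M => \sum_(m < M) ker t n m * sg m) : i j / (i <= j)%N >-> i <= j}.
  apply: homo_leq => [//|i j k|i]; first exact: le_trans.
  by rewrite big_ord_recr lerDl mulr_ge0 ?ker_ge0.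
have lim : (\sum_(m < M) ker t n m * sg m @[M --> \oo] --> sg n)%classic.
  move: t0; rewrite le_eqVlt => /predU1P[<-|t0].
    apply: cvg_near_cst; near=> N.
    under eq_bigr do rewrite ker0// eq_sym.
    by rewrite sum_delta//; near: N; exact: nbhs_infty_gt.
  have [d hd] := sigma_poly alphaN1.
  apply: (@kernel_trajectory n d t 1 (fun=> sg)) => // s m _.
  - by rewrite rtau_sigma// oppr0; exact: rderiv_cst.
  - exact: lcont_cst.
  - by rewrite ger0_norm ?s0// mul1r.
rewrite -(cvg_lim _ lim)//; apply: (nondecreasing_cvgn_le mono).
by apply/cvg_ex; exists (sg n).
Unshelve. all: by end_near. Qed.

(** Schur's test with the weight sigma: the symmetric kernel is a contraction. *)
Lemma ker_schur t N M x : 0 <= t ->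
  \sum_(n < N) (\sum_(m < M) ker t n m * x m) ^+ 2 <= \sum_(m < M) x m ^+ 2.
Proof.
move=> t0; have s0 m := sigma_gt0 alphaN1 m.
have k0 n m := ker_ge0 alphaN1 n m t0.
have row n : (\sum_(m < M) ker t n m * x m) ^+ 2 <=
    sg n * \sum_(m < M) ker t n m * (x m ^+ 2 / sg m).
  apply: le_trans (_ : (\sum_(m < M) ker t n m * sg m) *
      (\sum_(m < M) ker t n m * (x m ^+ 2 / sg m)) <= _); last first.
    apply: ler_wpM2r; last exact: ker_sigma_sum.
    by apply: sumr_ge0 => m _; rewrite mulr_ge0// divr_ge0 ?sqr_ge0// ltW.
  have := cauchy_sum M (fun m => Num.sqrt (ker t n m * sg m))
    (fun m => Num.sqrt (ker t n m / sg m) * x m).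
  congr (_ <= _); [congr (_ ^+ 2)|congr (_ * _)]; apply: eq_bigr => m _ /=.
  - rewrite mulrA -sqrtrM; last exact: mulr_ge0 (k0 n m) (ltW (s0 m)).
    have -> : ker t n m * sg m * (ker t n m / sg m) = ker t n m ^+ 2.
      by field; rewrite gt_eqF.
    by rewrite sqrtr_sqr ger0_norm.
  - by rewrite sqr_sqrtr//; exact: mulr_ge0 (k0 n m) (ltW (s0 m)).
  - rewrite exprMn sqr_sqrtr; first by rewrite mulrAC mulrA.
    exact: divr_ge0 (k0 n m) (ltW (s0 m)).
apply: (@le_trans _ _ (\sum_(n < N) sg n * \sum_(m < M) ker t n m * (x m ^+ 2 / sg m))).
  by apply: ler_sum => n _; exact: row.
under eq_bigr do rewrite mulr_sumr.
rewrite exchange_big /=; apply: ler_sum => m _.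
under eq_bigr do rewrite mulrA mulrA.
rewrite -mulr_suml ler_pdivrMr//.
have -> : \sum_(n < N) sg n * ker t n m * x m ^+ 2 = x m ^+ 2 * \sum_(n < N) ker t m n * sg n.
  by rewrite mulr_sumr; apply: eq_bigr => n _; rewrite (kerC _ t m); ring.
by rewrite ler_wpM2l ?sqr_ge0// ker_sigma_sum.
Qed.

Lemma ker_l2 t n : 0 <= t -> l2le (ker t n) 1.
Proof.
move=> t0; split=> // N; rewrite expr1n.
apply: le_trans (_ : \sum_(m < n.+1) ((m == n :> nat)%:R : R) ^+ 2 <= 1).
  apply: le_trans (ker_schur N n.+1 (delta n) t0).
  apply: ler_sum => m _.
  under [in leRHS]eq_bigr do rewrite mulrC.
  by rewrite (@sum_delta n n.+1 (ker t m))// kerC.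
under eq_bigr do rewrite expr2.
by rewrite (@sum_delta n n.+1 (delta n))// eqxx.
Qed.

Lemma ker_l2' t n : 0 <= t -> l2 (ker t n).
Proof. by exists 1; exact: ker_l2. Qed.

Lemma ker_le1 t n m : 0 <= t -> `|ker t n m| <= 1.
Proof. by move=> t0; apply: l2le_coord; exact: ker_l2. Qed.

Definition heat t x n := dot (ker t n) x.

Lemma heat_le t x a : 0 <= t -> l2le x a -> l2le (heat t x) a.
Proof.
move=> t0 xa; apply: (@l2le_cvg _ (fun M n => \sum_(m < M) ker t n m * x m)) => [n|].
  exact: dot_cvg (ker_l2 n t0) xa.
apply: nearW => M; split=> [|N]; first exact: l2le_ge0 xa.
by apply: le_trans (ker_schur N M x t0) _; case: xa.
Qed.

Lemma heat_l2 t x : 0 <= t -> l2 x -> l2 (heat t x).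
Proof. by move=> t0 [a xa]; exists a; exact: heat_le. Qed.

Lemma heat_lin t c x y : 0 <= t -> l2 x -> l2 y ->
  heat t (fun i => c * x i + y i) = (fun i => c * heat t x i + heat t y i).
Proof. by move=> t0 xl yl; apply/funext => n; rewrite /heat dot_lin//; exact: ker_l2'. Qed.

Lemma heatB t x y : 0 <= t -> l2 x -> l2 y ->
  heat t (fun i => x i - y i) = (fun i => heat t x i - heat t y i).
Proof.
move=> t0 xl yl; have h := heat_lin (-1) t0 yl xl.
have -> : (fun i => x i - y i) = (fun i => -1 * y i + x i) by apply/funext => i; ring.
by rewrite h; apply/funext => i; ring.
Qed.

Lemma heat_trunc t M x n : heat t (trunc M x) n = \sum_(m < M) ker t n m * x m.
Proof.
rewrite /heat (@dot_fin _ _ M) => [|i Mi]; last by rewrite /trunc ltnNge Mi mulr0.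
by apply: eq_bigr => i _; rewrite /trunc ltn_ord.
Qed.

Lemma heat0 x : heat 0 x = x.
Proof.
apply/funext => n; rewrite /heat (@dot_fin _ _ n.+1) => [|i ni].
  by under eq_bigr do rewrite ker0// eq_sym; rewrite sum_delta.
by rewrite ker0// ltn_eqF// mul0r.
Qed.

(** The trajectory r |-> ker (s + r) l starts at ker s l and ends at ker (s + t) l. *)
Lemma ker_semigroup s t n l : 0 < s -> 0 < t ->
  dot (ker t n) (ker s l) = ker (s + t) l n.
Proof.
move=> s0 t0; apply: (dot_unique (ker_l2 n (ltW t0)) (ker_l2 l (ltW s0))).
have dk (r : R) m : 0 <= r -> is_derive r 1 (fun u => ker (s + u) l m) (- rtau (ker (s + r) l) m).
  move=> r0; have sr : -1 < s + r by apply: lt_le_trans (ltrN10 R) _; rewrite addr_ge0// ltW.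
  have h1 := is_derive_ker alphaN1 l m sr.
  have h2 : is_derive r 1 (fun u : R => s + u) 1.
    have -> : (fun u : R => s + u) = cst s + @id R by [].
    by apply: is_derive_eq; rewrite add0r.
  by have := @is_derive1_comp R (fun u => ker u l m) (fun u => s + u) r _ _ h1 h2; rewrite mulr1.
have := @kernel_trajectory n 0 t 1 (fun r => ker (s + r) l) t0; rewrite addr0; apply.
- by move=> r m /andP[r0 _]; apply: rderiv_is_derive; exact: dk.
- by move=> r m /andP[r0 _]; apply: lcont_is_derive (dk r m (ltW r0)).
- by move=> r m /andP[r0 _]; rewrite expr0 mulr1 ker_le1// addr_ge0// ltW.
Qed.

(** Identities between bounded operators need only be checked on truncations. *)
Lemma l2_density (F G : (nat -> R) -> R) (C : R) x : l2 x ->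
  (forall y b, l2le y b -> `|F y| <= C * b /\ `|G y| <= C * b) ->
  (forall y, l2 y -> F (fun i => x i - y i) = F x - F y /\
                     G (fun i => x i - y i) = G x - G y) ->
  (forall M, F (trunc M x) = G (trunc M x)) -> F x = G x.
Proof.
move=> [a xa] FG lin eqt; apply/eqP; rewrite -subr_eq0 -normr_le0.
apply/ler_addgt0Pr => e e0; rewrite add0r.
have C1 : 0 < 2 * (`|C| + 1) by rewrite mulr_gt0// ltr_wpDl.
have d0 : 0 < e / (2 * (`|C| + 1)) by rewrite divr_gt0.
have [M0 /(_ M0 (leqnn _)) tl] := l2le_tail xa d0.
have [FE GE] := lin _ (l2_trunc M0 x); have [Fb Gb] := FG _ _ tl.
have -> : F x - G x = (F x - F (trunc M0 x)) - (G x - G (trunc M0 x)) by rewrite eqt; ring.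
rewrite -FE -GE; apply: le_trans (ler_normB _ _) _; apply: le_trans (lerD Fb Gb) _.
apply: le_trans (_ : `|C| * (e / (2 * (`|C| + 1))) + `|C| * (e / (2 * (`|C| + 1))) <= _).
  by apply: lerD; rewrite ler_wpM2r ?ler_norm// ltW.
rewrite -mulrDl mulrA ler_pdivrMr//.
rewrite -subr_ge0.
have -> : e * (2 * (`|C| + 1)) - (`|C| + `|C|) * e = 2 * e by ring.
by rewrite mulr_ge0// ltW.
Qed.

Lemma heatD s t x : 0 <= s -> 0 <= t -> l2 x -> heat (s + t) x = heat s (heat t x).
Proof.
move=> s0 t0 xl; move: (s0) (t0); rewrite le_eqVlt => /predU1P[<-|s1].
  by rewrite add0r heat0.
rewrite le_eqVlt => /predU1P[<-|t1]; first by rewrite addr0 heat0.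
apply/funext => n; have st0 : 0 <= s + t by exact: addr_ge0.
apply: (l2_density (F := fun x => heat (s + t) x n) (G := fun x => heat s (heat t x) n)
  (C := 1) xl) => [y b yb|y yl|M].
- by rewrite mul1r; split; apply: l2le_coord; do ?[exact: heat_le|apply: heat_le => //].
- split; first by rewrite heatB.
  by rewrite heatB// heatB//; exact: heat_l2.
- rewrite heat_trunc.
  have -> : heat t (trunc M x) = (fun m => \sum_(l < M) x l * ker t l m).
    apply/funext => m; rewrite heat_trunc; apply: eq_bigr => l _.
    by rewrite mulrC kerC.
  have [_ E] := dot_sum M x (ker_l2' n s0) (fun l => ker_l2' l t0).
  rewrite [RHS]/heat E.
  apply: eq_bigr => l _; rewrite ker_semigroup// mulrC (addrC t s); congr (_ * _).
  exact: kerC.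
Qed.

(** First order expansion of the semigroup at a vector of the maximal domain of
    H.  Duhamel's principle for the constant function x bounds the pairing of the
    error with any finitely supported vector, by the continuity modulus of
    e^{-sH} (H x); the truncated error itself is taken as that vector. *)
Lemma heat_expansion (h eta : R) x : 0 < h -> l2 x -> l2 (rtau x) ->
  (forall s, 0 <= s <= h ->
    l2le (fun i => heat s (rtau x) i - rtau x i) eta) ->
  l2le (fun i => heat h x i - x i + h * rtau x i) (h * eta).
Proof.
move=> h0 [a xa] [b yb] Heta; set y0 := rtau x in yb Heta *.
have h0' := ltW h0.
have eta0 : 0 <= eta by apply: l2le_ge0 (Heta 0 _); rewrite lexx.
set z := fun i => heat h x i - x i + h * y0 i.
split=> [|N]; first exact: mulr_ge0.
set S := \sum_(i < N) z i ^+ 2.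
have S0 : 0 <= S by apply: sumr_ge0 => i _; exact: sqr_ge0.
pose nz := Num.sqrt S; have nz0 : 0 <= nz by exact: sqrtr_ge0.
have nzS : nz ^+ 2 = S by rewrite sqr_sqrtr.
have pair v c : l2le v c -> `|\sum_(n < N) z n * v n| <= nz * c.
  move=> [c0 vc]; rewrite -ler_sqr ?nnegrE ?normr_ge0 ?mulr_ge0// real_normK ?num_real//.
  apply: le_trans (cauchy_sum _ _ _) _; rewrite exprMn nzS.
  by rewrite ler_wpM2l.
suff key : S <= h * eta * nz.
  move: nz0; rewrite le_eqVlt => /predU1P[nz00|nzp].
    by rewrite -nzS -nz00 expr0n sqr_ge0.
  have : nz <= h * eta by rewrite -(ler_pM2r nzp) -expr2 nzS.
  by move=> nzh; rewrite -nzS lerXn2r ?nnegrE ?mulr_ge0// ltW.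
apply/ler_addgt0Pr => e e0.
pose dl := e / 2 / ((nz + 1) * (1 + h)).
have nh0 : 0 < (nz + 1) * (1 + h) by rewrite mulr_gt0 ?ltr_wpDl// ltW.
have dl0 : 0 < dl by rewrite !divr_gt0.
have eh0 : 0 < e / 2 / h by rewrite !divr_gt0.
have [M1 hM1] := l2le_tail xa dl0; have [M2 hM2] := l2le_tail yb dl0.
have kd s m : 0 <= s < h -> rderiv ((fun=> x) ^~ m) s (y0 m - rtau x m).
  by move=> _; rewrite subrr; exact: rderiv_cst.
have kc s m : 0 < s <= h -> lcont ((fun=> x) ^~ m) s.
  by move=> _; exact: lcont_cst.
have kb s m : 0 <= s <= h -> `|x m| <= a * m.+1%:R ^+ 0.
  by move=> _; rewrite expr0 mulr1; exact: l2le_coord xa.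
have [M3 hM3] := kernel_variation alphaN1 z N (rho := fun _ => y0) (y := fun=> x) h0
   kd kc kb eh0.
pose M := maxn (maxn M1 M2) (maxn M3 N).
have ZE t (v : nat -> R) : \sum_(m < M.+1) test_ker alpha z N t m * v m =
    \sum_(n < N) z n * heat t (trunc M.+1 v) n.
  under eq_bigr do rewrite /test_ker mulr_suml.
  rewrite exchange_big /=; apply: eq_bigr => n _.
  by rewrite heat_trunc mulr_sumr; apply: eq_bigr => m _; rewrite mulrA.
have tx : l2le (fun i => x i - trunc M.+1 x i) dl.
  by apply: hM1; rewrite leqW// /M !leq_max leqnn.
have ty : l2le (fun i => y0 i - trunc M.+1 y0 i) dl.
  by apply: hM2; rewrite leqW// /M !leq_max leqnn !orbT.
have xl : l2 x by exists a.
have yl : l2 y0 by exists b.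
have hB s : 0 <= s < h -> `|\sum_(m < M.+1) test_ker alpha z N (h - s) m * y0 m -
    \sum_(n < N) z n * y0 n| <= nz * (eta + dl).
  move=> /andP[s0 sh]; have hs0 : 0 <= h - s by rewrite subr_ge0 ltW.
  rewrite ZE -sumrB; under eq_bigr do rewrite -mulrBr.
  apply: (pair (fun n => heat (h - s) (trunc M.+1 y0) n - y0 n) (eta + dl)).
  have hsh : 0 <= h - s <= h by rewrite hs0 gerBl.
  have := l2leB (Heta _ hsh) (heat_le hs0 ty).
  rewrite heatB//; last exact: l2_trunc.
  by apply: l2le_ext => i; ring.
have M3M : (M3 <= M)%N by rewrite /M !leq_max leqnn !orbT.
have := hM3 M _ _ M3M hB; rewrite !ZE.
have -> : \sum_(n < N) z n * heat 0 (trunc M.+1 x) n = \sum_(n < N) z n * x n.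
  apply: eq_bigr => n _; rewrite heat0 /trunc ifT// (leq_trans (ltn_ord n))//.
  by rewrite leqW// /M !leq_max leqnn !orbT.
move=> H1.
have H2 := pair _ _ (heat_le h0' tx).
have SE : S = - (\sum_(n < N) z n * x n - \sum_(n < N) z n * heat h (trunc M.+1 x) n -
     (\sum_(n < N) z n * y0 n) * h) + \sum_(n < N) z n * heat h (fun i => x i - trunc M.+1 x i) n.
  rewrite heatB//; last exact: l2_trunc.
  rewrite mulr_suml -!sumrB -sumrN -big_split /= /S; apply: eq_bigr => n _.
  by transitivity (z n * (heat h x n - x n + h * y0 n)); [rewrite expr2|ring].
have : S <= (nz * (eta + dl) + e / 2 / h) * h + nz * dl.
  rewrite -[leLHS]ger0_norm// SE; apply: le_trans (ler_normD _ _) _.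
  by rewrite normrN lerD.
move=> /le_trans; apply.
have -> : (nz * (eta + dl) + e / 2 / h) * h + nz * dl =
   h * eta * nz + (e / 2 + nz * (1 + h) * dl) by field; rewrite gt_eqF.
rewrite lerD2l [leRHS](splitr e) lerD2l /dl mulrA ler_pdivrMr// mulrC.
by rewrite ler_wpM2l ?divr_ge0 ?(ltW e0)// ler_wpM2r ?addr_ge0// lerDl.
Qed.

Lemma rtau_l2_fin x M : (forall i, (M <= i)%N -> x i = 0) -> l2 (rtau x).
Proof.
move=> x0; have [b hb] := l2_trunc M.+1 (rtau x); exists b.
apply: l2le_ext hb => i; rewrite /trunc; case: ifPn => //; rewrite -leqNgt.
case: i => // i Mi; have Mi' : (M <= i)%N by [].
by rewrite /rtau /= !x0 ?leqW//; ring.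
Qed.

(** Finitely supported vectors are in the domain, where the expansion gives a
    Lipschitz bound at 0; contractivity extends the continuity to l^2. *)
Lemma heat_continuous x (e : R) : l2 x -> 0 < e -> exists d : R, 0 < d /\
  forall h, 0 <= h <= d -> l2le (fun i => heat h x i - x i) e.
Proof.
move=> [a xa] e0; have xl : l2 x by exists a.
have e4 : 0 < e / 4 by rewrite divr_gt0.
have [M /(_ M (leqnn M)) tl] := l2le_tail xa e4; set w := trunc M x in tl.
have wl : l2 w by exact: l2_trunc.
have [b yb] : l2 (rtau w).
  by apply: (@rtau_l2_fin _ M) => i Mi; rewrite /w /trunc ltnNge Mi.
have b0 := l2le_ge0 yb.
have b3 : 0 < 3 * b + 1 by rewrite ltr_wpDl// mulr_ge0.
exists (e / 2 / (3 * b + 1)); split; first by rewrite !divr_gt0.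
move=> h /andP[h0 hd]; move: (h0); rewrite le_eqVlt => /predU1P[<-|hp].
  apply: (l2le_ext (x := fun=> 0)) => [i|]; first by rewrite heat0 subrr.
  by apply: l2le0; exact: ltW.
have ex := heat_expansion (eta := b + b) hp wl (ex_intro _ b yb)
  (fun s hs => l2leB (heat_le (proj1 (andP hs)) yb) yb).
have := l2leD (l2leB (l2leB (heat_le h0 tl) tl) (l2leZ h yb)) ex.
rewrite heatB// => H; apply: l2le_mono (l2le_ext _ H); last by move=> i; ring.
rewrite ger0_norm//; move: hd; rewrite ler_pdivlMr// => hd.
have -> : e / 4 + e / 4 + h * b + h * (b + b) = e / 2 + h * (3 * b) by field.
rewrite [leRHS](splitr e) lerD2l; apply: le_trans hd.
by rewrite ler_wpM2l// lerDl.
Qed.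

(** The expansion, divided by h.  It holds on the whole maximal domain of H, so
    that the generator extends -H itself, and not merely the closure of its
    restriction to finitely supported vectors. *)
Lemma heat_generator x (e : R) : l2 x -> l2 (rtau x) -> 0 < e -> exists d : R,
  0 < d /\ forall h, 0 < h < d ->
  l2le (fun i => h^-1 * (heat h x i - x i) + rtau x i) e.
Proof.
move=> xl yl e0; have [d [d0 hd]] := heat_continuous yl e0.
exists d; split=> // h /andP[h0 hd'].
have := heat_expansion (eta := e) h0 xl yl (fun s (hs : 0 <= s <= h) =>
  hd s (introT andP (conj (proj1 (andP hs)) (le_trans (proj2 (andP hs)) (ltW hd'))))).
move=> /(l2leZ h^-1); rewrite gtr0_norm ?invr_gt0// mulKf ?gt_eqF//.
by apply: l2le_ext => i; rewrite mulrDr mulKf ?gt_eqF.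
Qed.

Lemma delta_l2 n : l2 (delta n).
Proof.
have [b hb] := l2_trunc n.+1 (delta n); exists b.
apply: l2le_ext hb => i; rewrite /trunc; case: ifPn => //.
by rewrite -leqNgt => ni; rewrite gtn_eqF.
Qed.

(** Conversely, the generator acts as -tau, by the expansion at the unit vectors
    and the symmetry of the kernel. *)
Lemma heat_generator_tau x (v : nat -> R) : l2 x ->
  (forall e : R, 0 < e -> exists d : R, 0 < d /\ forall h, 0 < h < d ->
     l2le (fun i => h^-1 * (heat h x i - x i) - v i) e) ->
  forall n, v n = - rtau x n.
Proof.
move=> [a xa] hv n; apply/eqP; rewrite -subr_eq0 opprK -normr_le0.
apply/ler_addgt0Pr => e e0; rewrite add0r.
have a0 := l2le_ge0 xa.
have a1 : 0 < a + 1 by rewrite ltr_wpDl.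
have e2 : 0 < e / 2 by rewrite divr_gt0.
have ea : 0 < e / 2 / (a + 1) by rewrite divr_gt0.
have ydl : l2 (rtau (delta n)).
  by apply: (@rtau_l2_fin _ n.+1) => i ni; rewrite gtn_eqF.
have [d1 [d10 h1]] := hv _ e2.
have [d2 [d20 h2]] := heat_generator (delta_l2 n) ydl ea.
pose h := Num.min d1 d2 / 2.
have m0 : 0 < Num.min d1 d2 by rewrite lt_min d10.
have hm : h < Num.min d1 d2 by rewrite ltr_pdivrMr// ltr_pMr// ltr1n.
have h0 : 0 < h by rewrite divr_gt0.
move: hm; rewrite lt_min => /andP[hd1 hd2].
have {}h1 := l2le_coord n (h1 h (introT andP (conj h0 hd1))).
have {}h2 := h2 h (introT andP (conj h0 hd2)).
have := dot_le h2 xa.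
have -> : (fun i => h^-1 * (heat h (delta n) i - (i == n)%:R) + rtau (delta n) i) =
    (fun i => h^-1 * ker h n i + (- h^-1 * (i == n)%:R + rtau (delta n) i)).
  apply/funext => i; rewrite /heat (@dot_fin _ _ n.+1) => [|j nj]; last by rewrite gtn_eqF ?mulr0.
  under eq_bigr do rewrite mulrC.
  by rewrite (@sum_delta n n.+1 (ker h i))// kerC; ring.
have dl := delta_l2 n; have kl := ker_l2' n (ltW h0).
have xl : l2 x by exists a.
rewrite dotC dot_lin//; last exact: l2_lin.
rewrite dot_lin// (dotC x (ker h n)) -/(heat h x n).
have -> : dot x (delta n) = x n.
  rewrite dotC (@dot_fin _ _ n.+1) ?sum_delta// => i ni.
  by rewrite gtn_eqF ?mul0r.
have -> : dot x (rtau (delta n)) = rtau x n.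
  rewrite dotC (@dot_fin _ _ n.+2) => [|i].
    have := rtau_green alpha (delta n) x n.+1.
    rewrite sumrB (@sum_delta n n.+2)// !gtn_eqF// => /eqP.
    by rewrite !mul0r subrr mulr0 subr_eq0 => /eqP.
  by case: i => // i ni; rewrite /rtau /= !gtn_eqF ?leqW//= !mulr0n; ring.
move=> h3.
have -> : v n + rtau x n = (h^-1 * heat h x n + (- h^-1 * x n + rtau x n)) -
  (h^-1 * (heat h x n - x n) - v n) by ring.
apply: le_trans (ler_normB _ _) _; rewrite [leRHS](splitr e); apply: lerD => //.
apply: le_trans h3 _; rewrite mulrAC ler_pdivrMr// ler_wpM2l ?(ltW e2)//.
by rewrite lerDl.
Qed.

End RealHeat.

(** * Complex sequences *)

Section Complexification.
Variable R : realType.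
Local Open Scope complex_scope.
Implicit Types (u v : cseq R) (x : nat -> R) (a e : R).
Local Notation l2 x := (exists a : R, l2le x a).

(** The real part for b = true, the imaginary part for b = false; the boolean
    lets one proof treat both. *)
Definition part (b : bool) u : nat -> R :=
  fun n => if b then complex.Re (u n) else complex.Im (u n).

Definition of_parts (x y : nat -> R) : cseq R := fun n => x n +i* y n.

Definition l2cle u a := forall b, l2le (part b u) a.

Lemma ReD (z w : R[i]) : complex.Re (z + w) = complex.Re z + complex.Re w.
Proof. by case: z; case: w. Qed.
Lemma ImD (z w : R[i]) : complex.Im (z + w) = complex.Im z + complex.Im w.
Proof. by case: z; case: w. Qed.
Lemma ReM (z w : R[i]) : complex.Re (z * w) =
  complex.Re z * complex.Re w - complex.Im z * complex.Im w.
Proof. by case: z; case: w. Qed.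
Lemma ImM (z w : R[i]) : complex.Im (z * w) =
  complex.Re z * complex.Im w + complex.Im z * complex.Re w.
Proof. by case: z; case: w. Qed.
Lemma ReN (z : R[i]) : complex.Re (- z) = - complex.Re z.
Proof. by case: z. Qed.
Lemma ImN (z : R[i]) : complex.Im (- z) = - complex.Im z.
Proof. by case: z. Qed.

Definition partE := (ReD, ImD, ReM, ImM, ReN, ImN).

Lemma eq_part u v : (forall b n, part b u n = part b v n) -> u = v.
Proof.
move=> h; apply/funext => n; have := h true n; have := h false n; rewrite /part.
by case: (u n) => ? ?; case: (v n) => ? ? /= -> ->.
Qed.

Lemma part_lin b (c : R) u v n :
  part b (fun i => c%:C * u i + v i) n = c * part b u n + part b v n.
Proof. by case: b; rewrite /part !partE /=; ring. Qed.

Lemma partB b u v n : part b (fun i => u i - v i) n = part b u n - part b v n.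
Proof. by case: b; rewrite /part !partE. Qed.

Lemma normc_sqr (z : R[i]) :
  ComplexField.Normc.normc z ^+ 2 = complex.Re z ^+ 2 + complex.Im z ^+ 2.
Proof. by case: z => p q /=; rewrite sqr_sqrtr// addr_ge0 ?sqr_ge0. Qed.

Lemma l2sq_le u (c : R) : (forall N, \sum_(n < N) (part true u n ^+ 2 + part false u n ^+ 2) <= c) ->
  (l2sq u <= c%:E)%E.
Proof.
move=> h; apply: lime_le; first by apply: is_cvg_nneseries => n _ _; rewrite lee_fin sqr_ge0.
apply: nearW => N; rewrite sumEFin lee_fin big_mkord; apply: le_trans (h N).
by apply: ler_sum => n _; rewrite normc_sqr.
Qed.

Lemma l2sq_ge u (c : R) N : (l2sq u <= c%:E)%E ->
  \sum_(n < N) (part true u n ^+ 2 + part false u n ^+ 2) <= c.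
Proof.
move=> h; rewrite -lee_fin; apply: le_trans h.
apply: le_trans (nneseries_lim_ge N _); last by move=> n _ _; rewrite lee_fin sqr_ge0.
rewrite sumEFin lee_fin big_mkord; apply: ler_sum => n _.
by rewrite normc_sqr.
Qed.

Lemma l2sq_ge0 u : (0 <= l2sq u)%E.
Proof. by apply: nneseries_ge0 => n _ _; rewrite lee_fin sqr_ge0. Qed.

Lemma l2cle_l2sq u a : l2cle u a -> (l2sq u <= ((2 * a) ^+ 2)%:E)%E.
Proof.
move=> ua; apply: l2sq_le => N; rewrite big_split /=.
have [a0 h1] := ua true; have [_ h2] := ua false.
have := h1 N; have := h2 N; have := sqr_ge0 a; rewrite exprMn => ? ? ?; lra.
Qed.

Lemma l2sq_l2cle u a : 0 <= a -> (l2sq u <= (a ^+ 2)%:E)%E -> l2cle u a.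
Proof.
move=> a0 h b; split=> // N; apply: le_trans (l2sq_ge N h).
by apply: ler_sum => n _; case: b; rewrite ?lerDl ?lerDr sqr_ge0.
Qed.

Lemma ell2_l2cle u : ell2 u -> exists2 a, l2cle u a & l2sq u = (a ^+ 2)%:E.
Proof.
move=> ul; have fu : l2sq u \is a fin_num by rewrite ge0_fin_numE ?l2sq_ge0.
have f0 : 0 <= fine (l2sq u) by rewrite fine_ge0 ?l2sq_ge0.
exists (Num.sqrt (fine (l2sq u))); last by rewrite sqr_sqrtr// fineK.
by apply: l2sq_l2cle; rewrite ?sqrtr_ge0// sqr_sqrtr// fineK.
Qed.

Lemma l2cle_ell2 u a : l2cle u a -> ell2 u.
Proof. by move=> /l2cle_l2sq h; apply: le_lt_trans h _; rewrite ltry. Qed.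

Lemma ell2P u : ell2 u <-> forall b, l2 (part b u).
Proof.
split=> [/ell2_l2cle[a ua _] b|h]; first by exists a.
have [a1 h1] := h true; have [a2 h2] := h false.
apply: (@l2cle_ell2 _ (a1 + a2)) => -[].
- by apply: l2le_mono h1; rewrite lerDl; exact: l2le_ge0 h2.
- by apply: l2le_mono h2; rewrite lerDr; exact: l2le_ge0 h1.
Qed.

Lemma cvg_l2P (f : R -> cseq R) v : cvg_l2_right0 f v <->
  forall e, 0 < e -> exists d : R, 0 < d /\
    forall h, 0 < h < d -> l2cle (fun n => f h n - v n) e.
Proof.
split=> [/fine_cvgP[fin cv] e e0|H].
- have e20 : 0 < e ^+ 2 by rewrite exprn_gt0.
  have /cvgrPdist_le/(_ _ e20) c2 := cv.
  have [d [d0 hd]] := near_right0 (filterI fin c2).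
  exists d; split=> // h /hd[/= h1 h2]; apply: l2sq_l2cle; first exact: ltW.
  rewrite -(fineK h1) lee_fin; apply: le_trans h2.
  by rewrite sub0r normrN ler_norm.
- apply/fine_cvgP; split.
    have [d [d0 hd]] := H 1 ltr01.
    apply: (near_right0P d0) => h /hd /l2cle_ell2.
    by rewrite ge0_fin_numE ?l2sq_ge0.
  apply/cvgrPdist_le => e e0.
  have se : 0 < Num.sqrt e / 2 by rewrite divr_gt0 ?sqrtr_gt0.
  have [d [d0 hd]] := H _ se.
  apply: (near_right0P d0) => h /hd hh /=.
  have := l2cle_l2sq hh; rewrite mulrCA divff ?mulr1 ?pnatr_eq0// sqr_sqrtr ?(ltW e0)//.
  have := l2cle_ell2 hh; rewrite /ell2 /= -ge0_fin_numE ?l2sq_ge0// => fh.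
  rewrite -[X in (X <= _)%E](fineK fh) lee_fin sub0r normrN ger0_norm//.
  by apply: fine_ge0; exact: l2sq_ge0.
Qed.

Lemma ell2_lin (c : R[i]) u v : ell2 u -> ell2 v -> ell2 (fun n => c * u n + v n).
Proof.
move=> /ell2P ul /ell2P vl; apply/ell2P => b.
have [l1 l2] := (ul true, ul false).
case: b.
- have [a h] := l2_lin (complex.Re c) l1 (l2_lin (- complex.Im c) l2 (vl true)).
  by exists a; apply: l2le_ext h => n; rewrite /part !partE; ring.
- have [a h] := l2_lin (complex.Re c) l2 (l2_lin (complex.Im c) l1 (vl false)).
  by exists a; apply: l2le_ext h => n; rewrite /part !partE; ring.
Qed.

End Complexification.

Section ComplexHeat.
Variables (R : realType) (alpha : R).
Hypothesis alphaN1 : -1 < alpha.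
Local Open Scope complex_scope.
Implicit Types (u v : cseq R) (s t : R).
Local Notation l2 x := (exists a : R, l2le x a).
Local Notation A := (opp_operator (laguerre alpha)).

Lemma part_tau b u n : part b (Defs.tau alpha u) n = rtau alpha (part b u) n.
Proof.
rewrite /Defs.tau /rtau /offdiag /part.
by case: b; case: n => [|n]; rewrite /= !partE /=; ring.
Qed.

Definition complex_heat t u : cseq R :=
  of_parts (heat alpha t (part true u)) (heat alpha t (part false u)).

Lemma part_complex_heat b t u : part b (complex_heat t u) = heat alpha t (part b u).
Proof. by case: b. Qed.

Lemma complex_heat_l2cle t u a : 0 <= t -> l2cle u a -> l2cle (complex_heat t u) a.
Proof. by move=> t0 ua b; rewrite part_complex_heat; exact: heat_le. Qed.

Lemma complex_heat_linear t (c : R[i]) u v : 0 <= t -> ell2 u -> ell2 v ->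
  complex_heat t (fun n => c * u n + v n) = (fun n => c * complex_heat t u n + complex_heat t v n).
Proof.
move=> t0 /ell2P ul /ell2P vl; apply: eq_part => b n; rewrite part_complex_heat.
have [l1 l2] := (ul true, ul false).
case: b; rewrite {2}/part !partE.
- have -> : part true (fun n => c * u n + v n) = (fun i => complex.Re c * part true u i +
      (- complex.Im c * part false u i + part true v i)).
    by apply/funext => i; rewrite /part !partE; ring.
  rewrite heat_lin ?heat_lin//; last exact: l2_lin.
  by rewrite /=; ring.
- have -> : part false (fun n => c * u n + v n) = (fun i => complex.Re c * part false u i +
      (complex.Im c * part true u i + part false v i)).
    by apply/funext => i; rewrite /part !partE; ring.
  rewrite heat_lin ?heat_lin//; last exact: l2_lin.
  by rewrite /=; ring.
Qed.

Lemma complex_heat_C0 : is_C0_semigroup complex_heat.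
Proof.
split.
- by move=> t u t0 /ell2_l2cle[a ua _]; apply: (@l2cle_ell2 _ _ a); exact: complex_heat_l2cle.
- exact: complex_heat_linear.
- move=> t t0; exists (2 ^+ 2) => u /ell2_l2cle[a ua ->].
  by rewrite -EFinM -exprMn; apply: l2cle_l2sq; exact: complex_heat_l2cle.
- by move=> u _; apply: eq_part => b n; rewrite part_complex_heat heat0.
- move=> s t u s0 t0 /ell2P ul; apply: eq_part => b n.
  by rewrite !part_complex_heat heatD.
- move=> u /ell2P ul; apply/cvg_l2P => e e0.
  have [d1 [d10 h1]] := heat_continuous alphaN1 (ul true) e0.
  have [d2 [d20 h2]] := heat_continuous alphaN1 (ul false) e0.
  exists (Num.min d1 d2); split; first by rewrite lt_min d10.
  move=> h; rewrite lt_min => /and3P[h0 hd1 hd2] b.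
  apply: (l2le_ext (x := fun i => heat alpha h (part b u) i - part b u i)).
    by move=> i; rewrite partB part_complex_heat.
  by case: b; [apply: h1|apply: h2]; rewrite (ltW h0) ltW.
Qed.

(** As tau has real coefficients, membership in the graph of -H is a condition on
    the real and imaginary parts separately. *)
Lemma laguerreP u v : A (u, v) <->
  [/\ ell2 u, ell2 (Defs.tau alpha u) & forall b n, part b v n = - rtau alpha (part b u) n].
Proof.
split=> -[h1 h2 h3]; split=> //=.
- by move=> b n; rewrite -part_tau -h3 /part; case: b; rewrite partE opprK.
- apply: eq_part => b n; rewrite part_tau; have := h3 b n; rewrite /part.
  by case: b; rewrite partE => ->; rewrite opprK.
Qed.

Lemma part_quot b (h : R) u' u v i :
  part b (fun n => (h^-1)%:C * (u' n - u n) - v n) i =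
  h^-1 * (part b u' i - part b u i) - part b v i.
Proof. by case: b; rewrite /part !partE /=; ring. Qed.

Lemma complex_heat_generator : generator complex_heat = A.
Proof.
apply/seteqP; split=> -[u v].
- move=> [/= ul vl /cvg_l2P H].
  have key b n : part b v n = - rtau alpha (part b u) n.
    have ulb := (ell2P u).1 ul b.
    apply: (heat_generator_tau alphaN1 ulb) => e e0.
    have [d [d0 hd]] := H e e0; exists d; split=> // h hh.
    by apply: l2le_ext (hd h hh b) => i /=; rewrite part_quot part_complex_heat.
  apply/laguerreP; split=> //; apply/ell2P => b.
  have [a ha] := (ell2P v).1 vl b; exists a.
  by apply: l2le_ext (l2leN ha) => i; rewrite part_tau key opprK.
- move=> /laguerreP[ul tl key].
  have rl b : l2 (rtau alpha (part b u)).
    have [a ha] := (ell2P _).1 tl b; exists a.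
    by apply: l2le_ext ha => i; rewrite part_tau.
  split=> //=.
    apply/ell2P => b; have [a ha] := rl b; exists a.
    by apply: l2le_ext (l2leN ha) => i; rewrite key.
  apply/cvg_l2P => e e0; have uP := (ell2P u).1 ul.
  have [d1 [d10 h1]] := heat_generator alphaN1 (uP true) (rl true) e0.
  have [d2 [d20 h2]] := heat_generator alphaN1 (uP false) (rl false) e0.
  exists (Num.min d1 d2); split; first by rewrite lt_min d10.
  move=> h; rewrite lt_min => /and3P[h0 hd1 hd2] b.
  apply: (l2le_ext (x := fun i => h^-1 * (heat alpha h (part b u) i - part b u i) +
     rtau alpha (part b u) i)).
    by move=> i /=; rewrite part_quot part_complex_heat key opprK.
  by case: b; [apply: h1|apply: h2]; rewrite h0.
Qed.

(** Since -H generates a semigroup, the choice made in the definition of the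
    exponential is one, and not the default value. *)
Lemma exp_operatorP : is_C0_semigroup (exp_operator A) /\ generator (exp_operator A) = A.
Proof.
apply: (@xgetPex _ _ [set T | is_C0_semigroup T /\ generator T = A]%classic).
by exists complex_heat; split; [exact: complex_heat_C0|exact: complex_heat_generator].
Qed.

End ComplexHeat.

(** * Uniqueness of the semigroup *)

Section Uniqueness.
Variables (R : realType) (alpha : R).
Hypothesis alphaN1 : -1 < alpha.
Local Open Scope complex_scope.
Variable T : R -> cseq R -> cseq R.
Hypothesis C0T : is_C0_semigroup T.
Implicit Types (u v : cseq R) (s t a : R).
Local Notation A := (opp_operator (laguerre alpha)).

Let emb (x : nat -> R) : cseq R := of_parts x (fun=> 0).

Let emb_l2cle x a : l2le x a -> l2cle (emb x) a.
Proof. by move=> xa [] //; apply: l2le0; exact: l2le_ge0 xa. Qed.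

Let TD (c : R[i]) s u v : 0 <= s -> ell2 u -> ell2 v ->
  T s (fun n => c * u n + v n) = (fun n => c * T s u n + T s v n).
Proof. by move=> s0 ul vl; rewrite (C0_linear C0T). Qed.

Let T_quot s (c : R) w u v : 0 <= s -> ell2 w -> ell2 u -> ell2 v ->
  T s (fun n => c%:C * (w n - u n) - v n) =
  (fun n => c%:C * (T s w n - T s u n) - T s v n).
Proof.
move=> s0 wl ul vl; pose v' : cseq R := fun n => (-2)%:C * v n + v n.
pose u' : cseq R := fun n => (- c)%:C * u n + v' n.
have vl' : ell2 v' by exact: ell2_lin.
have ul' : ell2 u' by exact: ell2_lin.
have -> : (fun n => c%:C * (w n - u n) - v n) = (fun n => c%:C * w n + u' n).
  by apply: eq_part => -[] n; rewrite /part !partE /=; ring.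
rewrite TD// TD// TD//.
by apply: eq_part => -[] n; rewrite /part !partE /=; ring.
Qed.

Let T_right_cont u (e : R) : ell2 u -> 0 < e -> exists d : R, 0 < d /\
  forall h, 0 < h < d -> l2cle (fun n => T h u n - u n) e.
Proof. by move=> ul e0; have /cvg_l2P := C0_continuous C0T ul; exact. Qed.

(* uniform boundedness, applied to the real and imaginary parts of the
   restriction of T s to real sequences *)
Let T_real_bound b : exists C d : R, 0 < d /\ forall s, 0 <= s <= d ->
  forall x a, l2le x a -> l2le (part b (T s (emb x))) (C * a).
Proof.
have embl x : (exists a : R, l2le x a) -> ell2 (emb x).
  by move=> [a xa]; apply: l2cle_ell2 (emb_l2cle xa).
apply: (uniform_bound_near0 (F := fun s x => part b (T s (emb x)))).
- move=> s x y s0 xl yl; apply/funext => n.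
  have -> : emb (fun i => x i + y i) = (fun i => 1%:C * emb x i + emb y i).
    by apply: eq_part => b' i; rewrite part_lin; case: b' => /=; rewrite /part /=; ring.
  by rewrite (TD _ s0 (embl _ xl) (embl _ yl)) part_lin mul1r.
- move=> s c x s0 xl; apply/funext => n.
  have -> : emb (fun i => c * x i) = (fun i => (c - 1)%:C * emb x i + emb x i).
    by apply: eq_part => b' i; rewrite part_lin; case: b' => /=; rewrite /part /=; ring.
  by rewrite (TD _ s0 (embl _ xl) (embl _ xl)) part_lin; ring.
- move=> s s0; have [M hM] := C0_bounded C0T s0.
  exists (Num.sqrt `|M| * 2) => x a xa; have a0 := l2le_ge0 xa.
  have xl : ell2 (emb x) by apply: embl; exists a.
  apply: (@l2sq_l2cle _ (T s (emb x)) _ _ _ b).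
    by rewrite !mulr_ge0 ?sqrtr_ge0.
  apply: le_trans (hM _ xl) _.
  apply: (@le_trans _ _ (`|M|%:E * l2sq (emb x))%E).
    by apply: lee_wpmul2r; [exact: l2sq_ge0|rewrite lee_fin ler_norm].
  rewrite -mulrA exprMn sqr_sqrtr// EFinM; apply: lee_wpmul2l; first by rewrite lee_fin.
  exact: l2cle_l2sq (emb_l2cle xa).
- move=> x [a xa]; have a0 := l2le_ge0 xa.
  have xl : ell2 (emb x) by apply: embl; exists a.
  have [d [d0 hd]] := T_right_cont xl ltr01.
  exists (1 + a), (d / 2); split; first by rewrite divr_gt0.
  move=> s /andP[s0 sd]; move: s0; rewrite le_eqVlt => /predU1P[<-|s0].
    rewrite (C0_id C0T)//; apply: l2le_mono (emb_l2cle xa b).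
    by rewrite lerDr.
  have sd' : 0 < s < d by rewrite s0 (le_lt_trans sd)// ltr_pdivrMr// ltr_pMr// ltr1n.
  apply: l2le_ext (l2leD (hd s sd' b) (emb_l2cle xa b)) => n.
  by rewrite partB subrK.
Qed.

Let bounded_by (C : R) s := forall u a, l2cle u a -> l2cle (T s u) (C * a).

Let T_bound_near0 : exists C d : R, [/\ 1 <= C, 0 < d &
  forall s, 0 <= s <= d -> bounded_by C s].
Proof.
have [Ct [dt [dt0 ht]]] := T_real_bound true.
have [Cf [df [df0 hf]]] := T_real_bound false.
exists (Num.max 1 (Ct + Cf)), (Num.min dt df).
split; [by rewrite le_max lexx|by rewrite lt_min dt0|].
move=> s /andP[s0]; rewrite le_min => /andP[st sf] u a ua b.
have a0 : 0 <= a by apply: l2le_ge0 (ua true).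
have uE : u = (fun n => 'i * emb (part false u) n + emb (part true u) n).
  by apply: eq_part => -[] n; rewrite /part !partE /=; ring.
have e1 : ell2 (emb (part false u)) by apply: (@l2cle_ell2 _ _ a); exact: emb_l2cle.
have e2 : ell2 (emb (part true u)) by apply: (@l2cle_ell2 _ _ a); exact: emb_l2cle.
apply: (@l2le_mono _ _ ((Ct + Cf) * a)).
  by rewrite ler_wpM2r// le_max lexx orbT.
have st' : 0 <= s <= dt by rewrite s0.
have sf' : 0 <= s <= df by rewrite s0.
rewrite uE TD// mulrDl; case: b.
- apply: l2le_ext (l2leB (ht s st' _ _ (ua true)) (hf s sf' _ _ (ua false))) => n.
  by rewrite [RHS]/part !partE /= /part /=; ring.
- rewrite addrC; apply: l2le_ext (l2leD (hf s sf' _ _ (ua true)) (ht s st' _ _ (ua false))) => n.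
  by rewrite [RHS]/part !partE /= /part /=; ring.
Qed.

Let T_bound_upto t : exists2 C : R, 0 <= C & forall s, 0 <= s <= t -> bounded_by C s.
Proof.
have [C [d [C1 d0 hd]]] := T_bound_near0.
have C0 : 0 <= C by apply: le_trans C1.
have key n s : 0 <= s <= n%:R * d -> bounded_by (C ^+ n) s.
  elim: n s => [|n IH] s.
    rewrite mul0r => /le_anti <- u a ua.
    by rewrite (C0_id C0T) ?expr0 ?mul1r//; exact: l2cle_ell2 ua.
  move=> /andP[s0 sn] u a ua.
  have [sd|ds] := leP s d.
    have h : l2cle (T s u) (C * a) by apply: hd ua; rewrite s0.
    move=> b; apply: l2le_mono (h b); rewrite exprS -mulrA ler_wpM2l//.
    by rewrite ler_peMl ?exprn_ege1//; exact: l2le_ge0 (ua b).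
  have sd0 : 0 <= s - d by rewrite subr_ge0 ltW.
  have h1 : l2cle (T (s - d) u) (C ^+ n * a).
    apply: IH ua; rewrite sd0 lerBlDr; move: sn.
    by rewrite -natr1 mulrDl mul1r.
  have sE : s = d + (s - d) by rewrite addrC subrK.
  rewrite sE (C0_add C0T) ?(ltW d0)//; last exact: l2cle_ell2 ua.
  by rewrite exprS -mulrA; apply: hd h1; rewrite (ltW d0) lexx.
exists (C ^+ (Num.trunc (t / d)).+1); first exact: exprn_ge0.
move=> s /andP[s0 st]; apply: key; rewrite s0 (le_trans st)//.
by rewrite -ler_pdivrMr// ltW// truncnS_gt.
Qed.

Hypothesis genT : generator T = A.

(** On the domain of H a semigroup generated by -H is a coordinatewise solution
    of u' = - tau u, so that it is given by the heat kernel.  Local boundedness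
    is used twice: for left continuity and for the growth of the solution. *)
Lemma semigroup_heat t u : 0 < t -> ell2 u -> ell2 (Defs.tau alpha u) ->
  T t u = complex_heat alpha t u.
Proof.
move=> t0 ul tl.
pose v : cseq R := fun n => - Defs.tau alpha u n.
have Auv : A (u, v) by split=> //=; apply/funext => n; rewrite opprK.
have [C C0 hC] := T_bound_upto t.
have [a ua _] := ell2_l2cle ul.
have vl : ell2 v by move: (Auv); rewrite -genT => -[].
have gen s : 0 <= s <= t -> A (T s u, T s v) /\ cvg_l2_right0
    (fun h n => (h^-1)%:C * (T h (T s u) n - T s u n)) (T s v).
  move=> hs; have s0 : 0 <= s by case/andP: hs.
  rewrite -genT.
  suff c : cvg_l2_right0 (fun h n => (h^-1)%:C * (T h (T s u) n - T s u n)) (T s v).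
    by split=> //; split=> //=; apply: (C0_ell2 C0T).
  have : generator T (u, v) by rewrite genT.
  move=> [_ _ /cvg_l2P H]; apply/cvg_l2P => e e0.
  have C1 : 0 < C + 1 by rewrite ltr_wpDl.
  have [d [d0 hd]] := H (e / (C + 1)) (divr_gt0 e0 C1).
  exists d; split=> // h hh; have h0 : 0 < h by case/andP: hh.
  have h0' := ltW h0.
  have Thu : ell2 (T h u) by exact: (C0_ell2 C0T).
  have := hC s hs _ _ (hd h hh).
  rewrite T_quot// -(C0_add C0T)// addrC (C0_add C0T)//.
  move=> H' b; apply: l2le_mono (H' b).
  by rewrite mulrCA ler_piMr ?(ltW e0)// ler_pdivrMr// mul1r lerDl.
apply: eq_part => b n; rewrite part_complex_heat.
have ubl := (ell2P u).1 ul b.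
have [c kl] := ker_l2' alphaN1 n (ltW t0); have [a' ul'] := ubl.
symmetry; apply: (dot_unique kl ul').
have u0 : part b u = part b (T 0 u) by rewrite (C0_id C0T).
rewrite u0; apply: (@kernel_trajectory _ _ alphaN1 n 0 t (C * a) (fun s => part b (T s u))) => // [s m|s m|s m hs].
- move=> /andP[s0 st]; have hs : 0 <= s <= t by rewrite s0 ltW.
  have [/laguerreP[_ _ key] /cvg_l2P H] := gen s hs.
  rewrite -key; apply/cvgrPdist_le => e e0.
  have [d [d0 hd]] := H e e0; apply: (near_right0P d0) => h hh.
  have := l2le_coord m (hd h hh b); rewrite part_quot distrC.
  by rewrite (addrC s h) (C0_add C0T)//; case/andP: hh => /ltW.
- move=> /andP[s0 st]; apply/cvgrPdist_le => e e0.
  have C1 : 0 < C + 1 by rewrite ltr_wpDl.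
  have [d [d0 hd]] := T_right_cont ul (divr_gt0 e0 C1).
  have m0 : 0 < Num.min d s by rewrite lt_min d0.
  apply: (near_right0P m0) => h; rewrite lt_min => /and3P[h0 hd' hs'].
  have sh : 0 <= s - h by rewrite subr_ge0 ltW.
  have hsh : 0 <= s - h <= t by rewrite sh (le_trans _ st)// gerBl ltW.
  have hh : 0 < h < d by rewrite h0.
  have := l2le_coord m (hC _ hsh _ _ (hd h hh) b).
  have Thu : ell2 (T h u) by apply: (C0_ell2 C0T) => //; exact: ltW.
  have -> : (fun i => T h u i - u i) = (fun i => (-1)%:C * u i + T h u i).
    by apply: eq_part => -[] i; rewrite /part !partE /=; ring.
  rewrite TD// part_lin -(C0_add C0T) ?(ltW h0)// subrK mulN1r addrC => H.
  apply: le_trans H _.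
  by rewrite mulrCA ler_piMr ?(ltW e0)// ler_pdivrMr// mul1r lerDl.
- by rewrite expr0 mulr1; apply: l2le_coord; exact: hC.
Qed.

End Uniqueness.

(** * The norm *)

Section HeatNorm.
Variables (R : realType) (alpha : R).
Hypothesis alphaN1 : -1 < alpha.
Local Open Scope complex_scope.
Implicit Types (u : cseq R) (t : R).
Local Notation beta := (alpha + 1).
Local Notation sg := (sigma alpha).
Local Notation ker := (heat_kernel alpha).
Local Notation normc := ComplexField.Normc.normc.

Lemma normc_norm (z : R[i]) : `|z| = (normc z)%:C.
Proof. by case: z. Qed.

Lemma finsupp_ell2 u N : (forall n, (N <= n)%N -> u n = 0) ->
  ell2 u /\ ell2 (Defs.tau alpha u).
Proof.
move=> u0; have p0 b i : (N <= i)%N -> part b u i = 0.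
  by move=> Ni; rewrite /part u0//; case: b.
split; apply/ell2P => b.
  have [a ha] := l2_trunc N (part b u); exists a; apply: l2le_ext ha => i.
  by rewrite /trunc; case: ifPn => //; rewrite -leqNgt => /(p0 b) ->.
have [a ha] := rtau_l2_fin alpha (p0 b); exists a.
by apply: l2le_ext ha => i; rewrite part_tau.
Qed.

Lemma laguerre_heat_fin t u N n : 0 < t -> (forall n, (N <= n)%N -> u n = 0) ->
  laguerre_heat alpha t u n = \sum_(m < N) (ker t n m)%:C * u m.
Proof.
move=> t0 u0; have [ul tl] := finsupp_ell2 u0.
have [C0T genT] := exp_operatorP alphaN1.
rewrite /laguerre_heat (semigroup_heat alphaN1 C0T genT t0 ul tl).
have part_sum b : heat alpha t (part b u) n = \sum_(m < N) ker t n m * part b u m.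
  rewrite /heat (@dot_fin _ _ _ N)// => i Ni.
  by rewrite /part u0//; case: b; rewrite mulr0.
rewrite /complex_heat /of_parts !part_sum.
elim: N {u0 part_sum} => [|N IH]; first by rewrite !big_ord0.
by rewrite !big_ord_recr /= -IH /part; case: (u N) => p q; simpc.
Qed.

Lemma normc_sum_le N (z : nat -> R[i]) :
  normc (\sum_(m < N) z m) <= \sum_(m < N) normc (z m).
Proof.
have := ler_norm_sum (index_enum 'I_N) (fun m : 'I_N => z m) xpredT.
rewrite normc_norm; under [X in _ <= X]eq_bigr do rewrite normc_norm.
by rewrite -rmorph_sum /= lecR.
Qed.

Lemma l1norm_fin u (w : nat -> R) N : (forall n, 0 <= w n) ->
  (l1norm w u <= 1)%E -> \sum_(m < N) normc (u m) * w m <= 1.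
Proof.
move=> w0 h; rewrite -lee_fin; apply: le_trans h.
have p n : (0 <= (normc (u n) * w n)%:E)%E.
  by rewrite lee_fin mulr_ge0//; case: (u n) => p q; exact: sqrtr_ge0.
apply: le_trans (nneseries_lim_ge N (fun n _ _ => p n)).
by rewrite sumEFin lee_fin big_mkord.
Qed.

(** The kernel bound, summed against |u_m| sigma_m. *)
Lemma heat_norm_le t : 0 <= alpha -> 0 < t ->
  (norm_l1_linf sg (fun n => (sg n)^-1)%R (laguerre_heat alpha t) <=
   ((1 + t) `^ (- beta))%:E)%E.
Proof.
move=> a0 t0; apply: ub_ereal_sup => _ [u [[N uN] u1] <-].
apply: ub_ereal_sup => _ [n _ <-]; rewrite lee_fin.
have sp m := sigma_gt0 alphaN1 m.
rewrite (laguerre_heat_fin n t0 uN) ler_pdivrMr//.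
apply: le_trans (normc_sum_le N (fun m => (ker t n m)%:C * u m)) _.
apply: (@le_trans _ _ (\sum_(m < N) (1 + t) `^ (- beta) * sg n * (normc (u m) * sg m))).
  apply: ler_sum => m _; rewrite ComplexField.Normc.normcM.
  have k0 := ker_ge0 alphaN1 n m (ltW t0).
  have -> : normc (ker t n m)%:C = ker t n m.
    by rewrite /normc /= expr0n addr0 sqrtr_sqr ger0_norm.
  have nu : 0 <= normc (u m) by case: (u m) => p q; exact: sqrtr_ge0.
  apply: le_trans (ler_wpM2r nu (ker_le alphaN1 n m a0 (ltW t0))) _.
  by rewrite le_eqVlt; apply/orP; left; apply/eqP; ring.
rewrite -mulr_sumr ler_piMr ?mulr_ge0 ?powR_ge0 ?(ltW (sp n))//.
by apply: l1norm_fin => // m; exact: ltW.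
Qed.

(** The unit vector at 0 has weighted norm 1, and its image has the value
    (1 + t)^(- beta) at 0. *)
Lemma heat_norm_ge t : 0 < t ->
  (((1 + t) `^ (- beta))%:E <=
   norm_l1_linf sg (fun n => (sg n)^-1)%R (laguerre_heat alpha t))%E.
Proof.
move=> t0; pose d0 : cseq R := fun n => (n == 0%N)%:R.
have d0N n : (1 <= n)%N -> d0 n = 0 by case: n.
have nd n : normc (d0 n) = (n == 0%N)%:R.
  by case: n => [|n]; rewrite /d0 /= ?expr0n ?expr1n ?addr0 ?sqrtr0 ?sqrtr1.
have d01 : (l1norm sg d0 <= 1)%E.
  apply: lime_le; first by apply: is_cvg_nneseries => n _ _;
    rewrite lee_fin nd mulr_ge0// ltW// sigma_gt0.
  apply: nearW => N; rewrite sumEFin lee_fin big_mkord.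
  case: N => [|N]; first by rewrite big_ord0.
  under eq_bigr do rewrite nd.
  by rewrite (@sum_delta _ 0 N.+1 sg)// sigma0.
apply: le_trans (ereal_sup_ubound (_ : _ (linfnorm _ (laguerre_heat alpha t d0)))); last first.
  by exists d0 => //; split=> //; exists 1%N.
apply: ereal_sup_ubound => /=; exists 0%N => //.
rewrite (laguerre_heat_fin 0 t0 d0N) big_ord1 /d0 eqxx mulr1 sigma0 invr1 mulr1.
rewrite (ker00 alpha (ltW t0)) /normc /= expr0n addr0 sqrtr_sqr ger0_norm//.
exact: powR_ge0.
Qed.

End HeatNorm.

Theorem theorem4p6 (R : realType) (alpha : R) :
  (0 <= alpha -> forall t : R, 0 < t ->
    norm_l1_linf (sigma alpha) (fun n => (sigma alpha n)^-1)%R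
      (laguerre_heat alpha t) = (1 / (1 + t) `^ (1 + alpha))%:E)
  /\
  (-1 < alpha -> alpha < 0 -> forall t : R, 0 < t ->
    ((1 / (1 + t) `^ (1 + alpha))%R%:E <=
      norm_l1_linf (sigma alpha) (fun n => (sigma alpha n)^-1)%R
        (laguerre_heat alpha t))%E).
Proof.
rewrite (addrC 1 alpha).
split=> [a0 t t0|a1 _ t t0]; rewrite div1r -powRN; last exact: heat_norm_ge.
have a1 : -1 < alpha by apply: lt_le_trans (ltrN10 R) a0.
by apply/eqP; rewrite eq_le heat_norm_le//= heat_norm_ge.
Qed.
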